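(* Let $M$ be an oriented $n$-dimensional Riemannian manifold with a $Spin^r(n)$ structure ($r\ge 2$), with auxiliary rank $r$ oriented Riemannian bundle $F$ endowed with a metric connection $\nabla^F$, and let $m\in\mathbb N$ be such that $S=S(TM)\otimes S(F)^{\otimes m}$ is globally defined. Let $(e_1,\dots,e_n)$ and $(f_1,\dots,f_r)$ be local orthonormal frames of $TM$ and $F$. Then for every $\phi\in\Gamma(S)$, $$\sum_{i,j}e_ie_j\cdot R^\theta(e_i,e_j)(\phi)=\frac{\mathrm R}{2}\phi+\sum_{k<l}\Theta_{kl}\cdot\kappa^m_{r*}(f_kf_l)\cdot\phi,$$ where $\mathrm R$ is the scalar curvature of $M$ and $\Theta_{kl}=\sum_{i<j}\Theta_{kl}(e_i,e_j)\,e_i\wedge e_j$.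
   Context: Clifford algebra: $Cl_n$ is generated by an orthonormal basis $e_1,\dots,e_n$ of $\mathbb R^n$ with $e_ie_j+e_je_i=-2\delta_{ij}$; $\Delta_n=\mathbb C^{2^{[n/2]}}$ is the complex spinor space, on which $Cl_n$ acts via $\kappa$ (the isomorphism $Cl_n\otimes\mathbb C\cong\mathrm{End}(\Delta_n)$ for $n$ even; for $n$ odd the isomorphism with $\mathrm{End}(\Delta_n)\oplus\mathrm{End}(\Delta_n)$ followed by the projection to the first summand). Clifford multiplication is $x\cdot\phi=\kappa(x)\phi$; $X\wedge Y$ acts as $X\cdot Y+\langle X,Y\rangle$. $Spin(n)\subset Cl_n$ has Lie algebra spanned by $e_ie_j$, $i<j$; $\lambda_n:Spin(n)\to SO(n)$ is the double cover, with $\lambda_{n*}(e_ie_j)=2E_{ij}$, $E_{ij}:e_i\mapsto e_j,\ e_j\mapsto -e_i$. $\kappa^m_r$ is the representation of $Spin(r)$ on $\Delta_r^{\otimes m}$, and $\kappa^m_{r*}(f_kf_l)$ is the sum over $a=1,\dots,m$ of Clifford multiplication by $f_kf_l$ in the $a$-th factor. On $\Delta_n\otimes\Delta_r^{\otimes m}$, vectors and forms of $\mathbb R^n$ act on $\Delta_n$ and $\kappa^m_{r*}(f_kf_l)$ acts on $\Delta_r^{\otimes m}$. $Spin^r(n)=(Spin(n)\times Spin(r))/\{\pm(1,1)\}$. A $Spin^r(n)$ structure on $M$ is a principal $SO(r)$-bundle $P_{SO(r)}$ and a principal $Spin^r(n)$-bundle $P$ with a 2:1 covering $P\to P_{SO(M)}\tilde\times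 P_{SO(r)}$ (fibered product) equivariant with respect to $\lambda_n\times\lambda_r$. $F$ is the rank $r$ vector bundle associated to $P_{SO(r)}$, and $S=S(TM)\otimes S(F)^{\otimes m}$ is the bundle with fiber $\Delta_n\otimes\Delta_r^{\otimes m}$ associated to the representation $\kappa_n\otimes\kappa_r^m$; it is globally defined if $m$ is odd (structure group $Spin^r(n)$), or if $M$ and $F$ are both Spin (group $Spin(n)\times Spin(r)$, any $m$), or if $M$ is Spin and $m$ is even (group $Spin(n)\times SO(r)$). $\nabla^\theta$ is the covariant derivative on $S$ induced by the Levi-Civita connection and $\nabla^F$, and $R^\theta(X,Y)=[\nabla^\theta_X,\nabla^\theta_Y]-\nabla^\theta_{[X,Y]}$; on $\psi\otimes\varphi$, $R^\theta(X,Y)(\psi\otimes\varphi)=\frac12\sum_{i<j}\langle R^M(X,Y)e_i,e_j\rangle e_ie_j\cdot\psi\otimes\varphi+\psi\otimes\frac12\sum_{k<l}\Theta_{kl}(X,Y)\kappa^m_{r*}(f_kf_l)\cdot\varphi$, where $\Theta_{kl}(X,Y)=\langle R^F(X,Y)f_k,f_l\rangle$. *)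

(* Defs.v *)
From HB Require Import structures.
From mathcomp Require Import all_boot all_order all_algebra.
From mathcomp Require Import all_classical all_reals all_analysis.
From mathcomp Require Import complex ring.

Set Implicit Arguments.
Unset Strict Implicit.
Unset Printing Implicit Defensive.

Import Order.TTheory GRing.Theory Num.Theory.
Import numFieldNormedType.Exports.

Local Open Scope classical_set_scope.
Local Open Scope ring_scope.

Definition symdiff n (A B : {set 'I_n}) : {set 'I_n} :=
  [set x | (x \in A) (+) (x \in B)].

(** For [A = {i_1 < ... < i_k}] put [e_A = e_{i_1} ... e_{i_k}].  With
    [e_i e_j + e_j e_i = - 2 delta_ij] one has
    [e_A e_B = (-1) ^ #{(i, j) in A x B | j <= i} e_{A symdiff B}]. *)
Definition clsign (K : comNzRingType) n (A B : {set 'I_n}) : K :=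
  \prod_i \prod_j (-1) ^+ [&& i \in A, j \in B & (j <= i)%N].

(** The element [x] stands for [\sum_A x A *: e_A]. *)
Definition clifford (K : comNzRingType) (n : nat) := {ffun {set 'I_n} -> K}.

HB.instance Definition _ (K : comNzRingType) n :=
  GRing.Lmodule.copy (clifford K n) {ffun {set 'I_n} -> K^o}.

Section CliffordRing.
Context (K : comNzRingType) (n : nat).
Local Notation Cl := (clifford K n).
Implicit Types (A B C D : {set 'I_n}) (x y z : Cl).

Definition clunit : Cl := [ffun A => (A == finset.set0)%:R].

Definition clmul x y : Cl :=
  [ffun C => \sum_A clsign K A (symdiff A C) * (x A * y (symdiff A C))].

Lemma symdiffA A B C : symdiff A (symdiff B C) = symdiff (symdiff A B) C.
Proof. by apply/setP => i; rewrite !inE addbA. Qed.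

Lemma symdiffC A B : symdiff A B = symdiff B A.
Proof. by apply/setP => i; rewrite !inE addbC. Qed.

Lemma symdiff0s A : symdiff finset.set0 A = A.
Proof. by apply/setP => i; rewrite !inE. Qed.

Lemma symdiffs0 A : symdiff A finset.set0 = A.
Proof. by rewrite symdiffC symdiff0s. Qed.

Lemma symdiffss A : symdiff A A = finset.set0.
Proof. by apply/setP => i; rewrite !inE addbb. Qed.

Lemma symdiffK A : involutive (symdiff A).
Proof. by move=> B; rewrite symdiffA symdiffss symdiff0s. Qed.

Lemma clsignMl A B C : clsign K (symdiff A B) C = clsign K A C * clsign K B C.
Proof.
rewrite /clsign -big_split; apply: eq_bigr => i _.
rewrite -big_split /=; apply: eq_bigr => j _.
by rewrite -signr_addb inE andb_addl.
Qed.

Lemma clsignMr A B C : clsign K A (symdiff B C) = clsign K A B * clsign K A C.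
Proof.
rewrite /clsign -big_split; apply: eq_bigr => i _.
rewrite -big_split /=; apply: eq_bigr => j _.
by rewrite -signr_addb inE andb_addl andb_addr.
Qed.

Lemma clsign0l A : clsign K finset.set0 A = 1.
Proof. by rewrite /clsign big1 // => i _; rewrite big1 // => j _; rewrite inE. Qed.

Lemma clsign0r A : clsign K A finset.set0 = 1.
Proof.
by rewrite /clsign big1 // => i _; rewrite big1 // => j _; rewrite inE andbF.
Qed.

Lemma clmulA : associative clmul.
Proof.
move=> x y z; apply/ffunP => D; rewrite !ffunE.
transitivity (\sum_A \sum_B clsign K A B * clsign K (symdiff A B) (symdiff B (symdiff A D))
    * (x A * y B * z (symdiff B (symdiff A D)))).
  apply: eq_bigr => A _; rewrite ffunE !mulr_sumr; apply: eq_bigr => B _.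
  set Z := symdiff B _.
  have -> : symdiff A D = symdiff B Z by rewrite /Z symdiffK.
  rewrite clsignMr clsignMl.
  by ring.
rewrite exchange_big /=.
under [RHS]eq_bigr => C _ do rewrite ffunE !(mulr_suml, mulr_sumr).
rewrite [RHS]exchange_big /= exchange_big /=; apply: eq_bigr => A _.
rewrite (reindex_inj (inv_inj (@symdiffK A))) /=; apply: eq_bigr => C _.
rewrite symdiffK symdiffA [symdiff (symdiff A C) A]symdiffC symdiffK.
by ring.
Qed.

Lemma clmul1x : left_id clunit clmul.
Proof.
move=> x; apply/ffunP => C; rewrite ffunE (bigD1 (finset.set0 : {set 'I_n})) //= big1 => [|A nA].
  by rewrite ffunE eqxx symdiff0s clsign0l !mul1r addr0.
by rewrite ffunE (negPf nA) mul0r mulr0.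
Qed.

Lemma clmulx1 : right_id clunit clmul.
Proof.
move=> x; apply/ffunP => C; rewrite ffunE (bigD1 C) //= big1 => [|A nA].
  by rewrite ffunE symdiffss eqxx clsign0r mul1r mulr1 addr0.
rewrite ffunE; case: eqP => [e|_]; last by rewrite !mulr0.
by move: nA; rewrite -[C](@symdiffK A) e symdiffs0 eqxx.
Qed.

Lemma clmulDl : left_distributive clmul +%R.
Proof.
move=> x y z; apply/ffunP => C; rewrite !ffunE -big_split.
by apply: eq_bigr => A _; rewrite ffunE mulrDl mulrDr.
Qed.

Lemma clmulDr : right_distributive clmul +%R.
Proof.
move=> x y z; apply/ffunP => C; rewrite !ffunE -big_split.
by apply: eq_bigr => A _; rewrite ffunE !mulrDr.
Qed.

Lemma clunit_neq0 : clunit != 0.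
Proof.
apply/eqP => /ffunP /(_ (finset.set0 : {set 'I_n})); rewrite !ffunE eqxx => /eqP.
by rewrite oner_eq0.
Qed.

End CliffordRing.

HB.instance Definition _ (K : comNzRingType) n :=
  GRing.Zmodule_isNzRing.Build (clifford K n)
    (@clmulA K n) (@clmul1x K n) (@clmulx1 K n) (@clmulDl K n) (@clmulDr K n)
    (@clunit_neq0 K n).

Definition clgen (K : comNzRingType) n (i : 'I_n) : clifford K n :=
  [ffun A => (A == [set i]%SET)%:R].

Lemma clgen_anticomm (K : comNzRingType) n (i j : 'I_n) :
  clgen K i * clgen K j + clgen K j * clgen K i =
  (- (2 * (i == j)%:R)) *: (1 : clifford K n).
Proof.
have E (k l : 'I_n) (C : {set 'I_n}) : (clgen K k * clgen K l) C =
   (-1) ^+ (l <= k)%N * (C == symdiff [set k]%SET [set l]%SET)%:R.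
  rewrite ffunE (bigD1 [set k]%SET) //= big1 => [|A nA]; last first.
    by rewrite ffunE (negPf nA) mul0r mulr0.
  rewrite !ffunE eqxx mul1r addr0.
  have -> : (symdiff [set k]%SET C == [set l]%SET) =
            (C == symdiff [set k]%SET [set l]%SET).
    by apply/eqP/eqP => [<-|->]; rewrite symdiffK.
  case: eqP => [->|_]; last by rewrite !mulr0.
  rewrite !mulr1 symdiffK /clsign (bigD1 k) //= [X in _ * X]big1 => [|a na]; last first.
    by rewrite big1 // => b _; rewrite inE (negPf na).
  rewrite (bigD1 l) //= big1 => [|b nb]; last by rewrite !inE (negPf nb) andbF.
  by rewrite !inE !eqxx !mulr1.
apply/ffunP => C; rewrite [LHS]ffunE !E [symdiff [set j]%SET _]symdiffC [RHS]ffunE.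
have -> : (1 : clifford K n) C = (C == finset.set0)%:R by rewrite ffunE.
have [->|nij] := eqVneq i j.
  rewrite leqnn symdiffss mulr1 -mulrDl; congr (_ * _).
  by rewrite expr1 -opprD.
rewrite mulr0 oppr0 scale0r -mulrDl.
have [h|h] := ltnP i j; first by rewrite (ltnW h) expr0 expr1 subrr mul0r.
have h' : (j < i)%N by rewrite ltn_neqAle h andbT eq_sym.
by rewrite leqNgt h' expr0 expr1 addrC subrr mul0r.
Qed.

Section Spin.
Context (R : realType).
Local Notation C := R[i].

Definition clvec n (x : 'cV[R]_n) : clifford R n := \sum_i x i 0 *: clgen R i.

Definition spin n : set (clifford R n) := [set x |
  exists2 s : seq 'cV[R]_n,
    ~~ odd (size s) /\ (forall v, v \in s -> \sum_i v i 0 ^+ 2 = 1) &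
    x = \prod_(v <- s) clvec v].

(** [is_lambda x A] says that [A] is the matrix of [lambda_n x], i.e. of
    [v |-> x v x^-1]; such an [A] is unique when [x] is in [spin n]. *)
Definition is_lambda n (x : clifford R n) (A : 'M[R]_n) :=
  forall v : 'cV[R]_n, x * clvec v = clvec (A *m v) * x.

Definition SO n : set 'M[R]_n := [set A | A^T *m A = 1%:M /\ \det A = 1].

Definition clcomplex n (x : clifford R n) : clifford C n :=
  [ffun A => (x A)%:C%C].

Local Notation spdim n := (2 ^ n./2)%N.
Local Notation tindex n r m := ('I_(spdim n) * {ffun 'I_m -> 'I_(spdim r)})%type.

(** [kappa], as a complex algebra map out of [Cl_n (x) C = clifford C n].  For
    odd [n] it is the first component of an isomorphism onto
    [End(Delta_n) (+) End(Delta_n)]. *)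
Record spinor_rep n := SpinorRep {
  kappa :> {linear clifford C n -> 'M[C]_(spdim n)};
  kappa_morph : monoid_morphism kappa;
  kappa_iso : if odd n then
      exists2 kappa' : {linear clifford C n -> 'M[C]_(spdim n)},
        monoid_morphism kappa' & bijective (fun x => (kappa x, kappa' x))
    else bijective kappa }.

(** [Delta_n (x) Delta_r^{(x) m}], in coordinates with respect to the tensor
    products of the standard bases. *)
Definition spinor n r m : Type :=
  {ffun tindex n r m -> C}.

HB.instance Definition _ n r m := GRing.Lmodule.copy (spinor n r m)
  {ffun tindex n r m -> C}.

Definition act_left n r m (A : 'M[C]_(spdim n)) (w : spinor n r m) :
    spinor n r m :=
  [ffun t : tindex n r m => \sum_i A t.1 i * w (i, t.2)].

Definition act_right n r m (a : 'I_m) (B : 'M[C]_(spdim r)) (w : spinor n r m) :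
    spinor n r m :=
  [ffun t : tindex n r m => \sum_k B (t.2 a) k *
     w (t.1, [ffun b => if b == a then k else t.2 b])].

(** [A (x) B (x) ... (x) B]. *)
Definition act_tensor n r m (A : 'M[C]_(spdim n)) (B : 'M[C]_(spdim r))
    (w : spinor n r m) : spinor n r m :=
  [ffun t : tindex n r m => \sum_i \sum_(k : {ffun 'I_m -> 'I_(spdim r)})
     A t.1 i * (\prod_a B (t.2 a) (k a)) * w (i, k)].

Variables (n r m : nat) (kn : spinor_rep n) (kr : spinor_rep r).

Definition clact (x : clifford R n) (w : spinor n r m) : spinor n r m :=
  act_left (kn (clcomplex x)) w.

(** [kappa^m_{r*}] on the Lie algebra of [Spin(r)]. *)
Definition kappam (y : clifford R r) (w : spinor n r m) : spinor n r m :=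
  \sum_a act_right a (kr (clcomplex y)) w.

(** [kappa_n (x) kappa^m_r] on [Spin(n) x Spin(r)]. *)
Definition spin_act (x : clifford R n * clifford R r) (w : spinor n r m) :
    spinor n r m :=
  act_tensor (kn (clcomplex x.1)) (kr (clcomplex x.2)) w.

End Spin.

Section Smooth.
Context (R : realType) (n : nat).
Implicit Types (D : set 'rV[R]_n) (f : 'rV[R]_n -> R).

Definition iter_derive (vs : seq 'rV[R]_n) f : 'rV[R]_n -> R :=
  foldr (fun v h x => 'D_v h x) f vs.

Definition smooth_rV D f := forall vs x, D x ->
  {for x, continuous (iter_derive vs f)} /\
  (forall v, derivable (iter_derive vs f) x v).

Record chart (M : topologicalType) := Chart {
  cdom : set M;
  cfwd : M -> 'rV[R]_n;
  cbwd : 'rV[R]_n -> M;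
  dom_open : open cdom;
  img_open : open (cfwd @` cdom);
  fwdK : forall p, cdom p -> cbwd (cfwd p) = p;
  fwd_continuous : {within cdom, continuous cfwd};
  bwd_continuous : {within cfwd @` cdom, continuous cbwd} }.

Record manifold := Manifold {
  points :> topologicalType;
  atlas : set (chart points);
  manifold_hausdorff : hausdorff_space points;
  manifold_countable : @second_countable points;
  atlas_cover : forall p, exists2 c, atlas c & cdom c p;
  atlas_compat : forall c c', atlas c -> atlas c' -> forall j,
    smooth_rV (cfwd c @` (cdom c `&` cdom c')) (fun x => cfwd c' (cbwd c x) 0 j) }.

(** An orientation is given by an atlas with positive Jacobians. *)
Definition oriented (M : manifold) :=
  forall c c', @atlas M c -> @atlas M c' -> forall p, cdom c p -> cdom c' p ->
  0 < \det (\matrix_(i, j)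
    'D_(delta_mx 0 i) (fun x => cfwd c' (cbwd c x) 0 j : R) (cfwd c p)).

End Smooth.

Section Manifold.
Context (R : realType) (n : nat) (M : manifold R n).
Implicit Types (U V : set M) (p : M) (f h : M -> R).

Definition smooth_fun U f := forall c, @atlas _ _ M c ->
  smooth_rV (cfwd c @` (cdom c `&` U)) (fun x => f (cbwd c x)).

Definition smooth_near p f := exists U, [/\ open U, U p & smooth_fun U f].

(** Smoothness of a map with values in a space with coordinates [co]. *)
Definition smooth_map (V J : Type) (co : J -> V -> R) U (s : M -> V) :=
  forall j, smooth_fun U (fun p => co j (s p)).

(** Tangent vectors are derivations of germs of smooth functions; a germ is
    given by any total function smooth near [p], and the value at the other
    functions is set to 0 so that equality of tangent vectors is [=]. *)
Definition tvector : Type := (M -> R) -> R.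
HB.instance Definition _ := GRing.Lmodule.copy tvector ((M -> R) -> R).

Definition tangent p (v : tvector) :=
  [/\ forall f, ~ smooth_near p f -> v f = 0,
      forall a f h, smooth_near p f -> smooth_near p h ->
        v (fun x => a * f x + h x) = a * v f + v h &
      forall f h, smooth_near p f -> smooth_near p h ->
        v (fun x => f x * h x) = v f * h p + f p * v h].

(** Vector fields and, below, sections of bundles over an open set [U] are
    total functions whose values outside [U] are irrelevant. *)
Definition vfield : Type := M -> tvector.

Definition vector_field U (X : vfield) :=
  (forall p, U p -> tangent p (X p)) /\
  (forall V f, open V -> V `<=` U -> smooth_fun V f ->
     smooth_fun V (fun p => X p f)).

Definition bracket (X Y : vfield) : vfield := fun p f =>
  if `[< smooth_near p f >] then
    X p (fun q => Y q f) - Y p (fun q => X q f)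
  else 0.

Record metric := Metric {
  metric_ip :> M -> tvector -> tvector -> R;
  ip_sym : forall p u v, tangent p u -> tangent p v -> metric_ip p u v = metric_ip p v u;
  ip_linear : forall p a u v w, tangent p u -> tangent p v -> tangent p w ->
    metric_ip p (a *: u + v) w = a * metric_ip p u w + metric_ip p v w;
  ip_pos : forall p u, tangent p u -> u <> 0 -> 0 < metric_ip p u u;
  ip_smooth : forall U X Y, open U -> vector_field U X -> vector_field U Y ->
    smooth_fun U (fun p => metric_ip p (X p) (Y p)) }.

Definition orthonormal_basis (g : metric) p (u : 'I_n -> tvector) :=
  [/\ forall i, tangent p (u i),
      forall i j, g p (u i) (u j) = (i == j)%:R &
      forall v, tangent p v -> exists a : 'I_n -> R, v = \sum_i a i *: u i].

Definition positive_basis p (u : 'I_n -> tvector) :=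
  forall c, @atlas _ _ M c -> cdom c p ->
  0 < \det (\matrix_(i, j) u i (fun x => cfwd c x 0 j)).

(** Connections on a vector bundle whose sections over [U] are the functions
    [B -> V] in [Gamma U], where [pi : B -> M]: for [TM], [B = M]; for an
    associated bundle, [B] is the principal bundle and sections are equivariant
    functions on it. *)
Section Connection.
Context (B : Type) (V : lmodType R) (pi : B -> M).
Variable Gamma : set M -> set (B -> V).
Implicit Types (X Y : vfield) (s t : B -> V) (D : vfield -> (B -> V) -> B -> V).

Record is_connection D : Prop := IsConnection {
  conn_section : forall U X s, open U -> vector_field U X -> Gamma U s ->
    Gamma U (D X s);
  conn_addl : forall U X Y s, open U -> vector_field U X -> vector_field U Y ->
    Gamma U s ->
    forall b, U (pi b) -> D (X + Y) s b = D X s b + D Y s b;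
  conn_scalel : forall U f X s, open U -> smooth_fun U f -> vector_field U X ->
    Gamma U s ->
    forall b, U (pi b) -> D (fun p => f p *: X p) s b = f (pi b) *: D X s b;
  conn_addr : forall U X s t, open U -> vector_field U X -> Gamma U s ->
    Gamma U t ->
    forall b, U (pi b) -> D X (s + t) b = D X s b + D X t b;
  conn_leibniz : forall U X f s, open U -> vector_field U X ->
    smooth_fun U f -> Gamma U s ->
    forall b, U (pi b) ->
      D X (fun b' => f (pi b') *: s b') b =
      X (pi b) f *: s b + f (pi b) *: D X s b }.

(** [h] is the function [<s, t>] on the base. *)
Definition metric_connection (dot : B -> V -> V -> R) D :=
  forall U X s t (h : M -> R), open U -> vector_field U X -> Gamma U s ->
    Gamma U t -> (forall b, U (pi b) -> h (pi b) = dot b (s b) (t b)) ->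
    forall b, U (pi b) ->
      X (pi b) h = dot b (D X s b) (t b) + dot b (s b) (D X t b).

End Connection.

Definition curvature (B : Type) (V : zmodType)
    (D : vfield -> (B -> V) -> B -> V) (X Y : vfield) (s : B -> V) (b : B) : V :=
  D X (D Y s) b - D Y (D X s) b - D (bracket X Y) s b.

Definition levi_civita (g : metric) (D : vfield -> vfield -> vfield) :=
  [/\ is_connection id vector_field D,
      metric_connection id vector_field (fun p => g p) D &
      forall U X Y, open U -> vector_field U X -> vector_field U Y ->
        forall p, U p -> D X Y p - D Y X p = bracket X Y p].

Definition orthonormal_frame (g : metric) U (e : 'I_n -> vfield) :=
  (forall i, vector_field U (e i)) /\
  (forall p, U p -> orthonormal_basis g p (fun i => e i p)).

(** [e] is any orthonormal frame near [p]. *)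
Definition scalar_curvature (g : metric) (D : vfield -> vfield -> vfield)
    (e : 'I_n -> vfield) p : R :=
  \sum_i \sum_j g p (curvature D (e i) (e j) (e j) p) (e i p).

(** [s] and [t] differ near [p] by a smooth [G]-valued function. *)
Definition smooth_transition (A : pzRingType) (J : Type) (co : J -> A -> R)
    (G : set A) (T : Type) (pb_act : T -> A -> T) (t s : M -> T) p :=
  exists V (k : M -> A), [/\ open V, V p, smooth_map co V k &
    forall q, V q -> G (k q) /\ s q = pb_act (t q) (k q)].

(** A principal bundle with structure group [G / K], where [G] is a group of
    invertible elements of the algebra [A] (with linear coordinates [co]) and
    [K] is a discrete normal subgroup of [G]; the smooth structure of the total
    space is given by an atlas of local sections [pb_sec].  A smooth map to
    [G / K] is one which locally lifts to a smooth map to [G]. *)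
Record principal_bundle (A : pzRingType) (J : Type) (co : J -> A -> R)
    (G K : set A) := PrincipalBundle {
  pb_total : Type;
  pb_proj : pb_total -> M;
  pb_act : pb_total -> A -> pb_total;
  pb_act_proj : forall q x, G x -> pb_proj (pb_act q x) = pb_proj q;
  pb_act1 : forall q, pb_act q 1 = q;
  pb_actM : forall q x y, G x -> G y -> pb_act q (x * y) = pb_act (pb_act q x) y;
  pb_act_trans : forall q q', pb_proj q = pb_proj q' -> exists2 x, G x & q' = pb_act q x;
  pb_act_stab : forall q x, G x -> (pb_act q x = q <-> K x);
  pb_index : Type;
  pb_patch : pb_index -> set M;
  pb_sec : pb_index -> M -> pb_total;
  pb_patch_open : forall i, open (pb_patch i);
  pb_patch_cover : forall p, exists i, pb_patch i p;
  pb_sec_proj : forall i p, pb_patch i p -> pb_proj (pb_sec i p) = p;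
  pb_sec_smooth : forall i j p, pb_patch i p -> pb_patch j p ->
    smooth_transition co G pb_act (pb_sec i) (pb_sec j) p }.

Arguments pb_proj {A J co G K} P q : rename.
Arguments pb_act {A J co G K} P q x : rename.
Arguments pb_patch {A J co G K} P i : rename.
Arguments pb_sec {A J co G K} P i p : rename.

Definition local_section (A : pzRingType) (J : Type) (co : J -> A -> R)
    (G K : set A) (P : principal_bundle co G K) U (s : M -> pb_total P) :=
  (forall p, U p -> pb_proj P (s p) = p) /\
  (forall i p, U p -> pb_patch P i p ->
     smooth_transition co G (pb_act P) (pb_sec P i) s p).

(** Sections over [U] of [P x_rho V], as equivariant functions on [P]. *)
Definition assoc_section (A : pzRingType) (J : Type) (co : J -> A -> R)
    (G K : set A) (P : principal_bundle co G K) (V I : Type)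
    (cv : I -> V -> R) (rho : A -> V -> V) U (s : pb_total P -> V) :=
  (forall q x, U (pb_proj P q) -> G x -> rho x (s (pb_act P q x)) = s q) /\
  (forall i, smooth_map cv (U `&` pb_patch P i) (fun p => s (pb_sec P i p))).

Definition mx_coord a b (ij : 'I_a * 'I_b) (A : 'M[R]_(a, b)) : R :=
  A ij.1 ij.2.

Definition so_bundle r :=
  principal_bundle (@mx_coord r r) (@SO R r) [set 1].

End Manifold.

Arguments vfield {R n} M.
Arguments tvector {R n} M.
Arguments pb_proj {R n M A J co G K} P q : rename.
Arguments pb_act {R n M A J co G K} P q x : rename.
Arguments pb_patch {R n M A J co G K} P i : rename.
Arguments pb_sec {R n M A J co G K} P i p : rename.

Section SpinStructures.
Context (R : realType) (n r m : nat) (M : manifold R n) (g : metric M).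
Variables (D : vfield M -> vfield M -> vfield M) (PF : so_bundle M r).
Implicit Types (U : set M) (p : M).

Definition F_section := assoc_section (P := PF) (@mx_coord R r 1) mulmx.

Definition F_dot (b : pb_total PF) (v w : 'cV[R]_r) : R := \sum_k v k 0 * w k 0.

Definition F_frame U (f : 'I_r -> pb_total PF -> 'cV[R]_r) :=
  (forall k, F_section U (f k)) /\
  (forall b, U (pb_proj PF b) -> forall k l, F_dot b (f k b) (f l b) = (k == l)%:R).

Definition F_connection (DF : vfield M -> (pb_total PF -> 'cV[R]_r) ->
    pb_total PF -> 'cV[R]_r) :=
  is_connection (pb_proj PF) F_section DF /\
  metric_connection (pb_proj PF) F_section F_dot DF.

Definition spin2_coord (I : {set 'I_n} + {set 'I_r})
    (x : clifford R n * clifford R r) : R :=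
  match I with inl A => x.1 A | inr B => x.2 B end.

Definition spin2 : set (clifford R n * clifford R r) :=
  [set x | spin x.1 /\ spin x.2].

(** A structure on [M] with group [(Spin(n) x Spin(r)) / K]: a principal bundle
    mapping smoothly and equivariantly, by [(frm, auxmap)], to the fibered
    product of the bundle of oriented orthonormal frames of [M] and [PF].
    Equivariance makes the fibers of this map the orbits of
    [ker (lambda_n x lambda_r) / K], so for [K = {(1,1), (-1,-1)}] it is 2:1. *)
Record spin_structure (K : set (clifford R n * clifford R r)) := SpinStructure {
  bundle :> principal_bundle M spin2_coord spin2 K;
  frm : pb_total bundle -> 'I_n -> tvector M;
  auxmap : pb_total bundle -> pb_total PF;
  frm_orthonormal : forall q, orthonormal_basis g (pb_proj bundle q) (frm q);
  frm_positive : forall q, positive_basis (pb_proj bundle q) (frm q);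
  aux_proj : forall q, pb_proj PF (auxmap q) = pb_proj bundle q;
  frm_act : forall q x A, spin2 x -> is_lambda x.1 A ->
    forall i, frm (pb_act bundle q x) i = \sum_j A j i *: frm q j;
  aux_act : forall q x A, spin2 x -> is_lambda x.2 A ->
    auxmap (pb_act bundle q x) = pb_act PF (auxmap q) A;
  frm_smooth : forall i k,
    vector_field (pb_patch bundle i) (fun p => frm (pb_sec bundle i p) k);
  aux_smooth : forall i,
    local_section (pb_patch bundle i) (fun p => auxmap (pb_sec bundle i p)) }.

Definition ker_spinr : set (clifford R n * clifford R r) :=
  [set x | x = (1, 1) \/ x = (-1, -1)].
Definition ker_spin_spin : set (clifford R n * clifford R r) :=
  [set x | x = (1, 1)].
Definition ker_spin_so : set (clifford R n * clifford R r) :=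
  [set x | x = (1, 1) \/ x = (1, -1)].

(** The cases in which [S] is globally defined, with the structure to which it
    is associated; [P] is the given [Spin^r(n)] structure. *)
Inductive globally_defined (P : spin_structure ker_spinr) :
    forall K, spin_structure K -> Prop :=
| GlobalSpinr : odd m -> globally_defined P P
| GlobalSpinSpin (Q : spin_structure ker_spin_spin) : globally_defined P Q
| GlobalSpinSO (Q : spin_structure ker_spin_so) : ~~ odd m ->
    globally_defined P Q.

Variables (DF : vfield M -> (pb_total PF -> 'cV[R]_r) -> pb_total PF -> 'cV[R]_r).
Variables (kn : spinor_rep R n) (kr : spinor_rep R r).
Variables (K : set (clifford R n * clifford R r)) (Q : spin_structure K).
Local Notation Delta := (spinor R n r m).

Definition spinor_coord (tb : ('I_(2 ^ n./2) * {ffun 'I_m -> 'I_(2 ^ r./2)}) * bool)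
    (w : Delta) : R :=
  if tb.2 then complex.Re (w tb.1) else complex.Im (w tb.1).

Definition S_section :=
  assoc_section (P := Q) spinor_coord (spin_act kn kr).

Definition spinor_derive (v : tvector M) (w : M -> Delta) : Delta :=
  [ffun t => (v (fun p => complex.Re (w p t)) +i*
              v (fun p => complex.Im (w p t)))%C].

(** [DS] is the covariant derivative [nabla^theta] on [S] induced by [D] and
    [DF]: in terms of a local section [s] of [Q], with the associated frames
    [u_i] of [TM] and [h_k] of [F], it is
    [d + 1/2 sum_{i<j} <D u_i, u_j> e_i e_j + 1/2 sum_{k<l} <DF h_k, h_l>
    kappa^m_{r*}(f_k f_l)], since [lambda_{n*}(e_i e_j) = 2 E_ij]. *)
Definition induced_connection
    (DS : vfield M -> (pb_total Q -> Delta) -> pb_total Q -> Delta) :=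
  forall U X phi, open U -> vector_field U X -> S_section U phi ->
  S_section U (DS X phi) /\
  forall (s : M -> pb_total Q) (h : 'I_r -> pb_total PF -> 'cV[R]_r),
    local_section U s ->
    (forall k, F_section U (h k)) ->
    (forall k p, U p -> h k (auxmap (s p)) = delta_mx k 0) ->
  forall p, U p ->
  DS X phi (s p) =
    spinor_derive (X p) (fun x => phi (s x))
    + 2^-1 *: (\sum_(i < n) \sum_(j < n | (i < j)%N)
        (g p (D X (fun x => frm (s x) i) p) (frm (s p) j))%:C%C *:
          clact kn (clgen R i * clgen R j) (phi (s p)))
    + 2^-1 *: (\sum_(k < r) \sum_(l < r | (k < l)%N)
        (F_dot (auxmap (s p)) (DF X (h k) (auxmap (s p))) (h l (auxmap (s p))))%:C%C *:
          kappam kr (clgen R k * clgen R l) (phi (s p))).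

(** Clifford multiplication on the fiber of [S] at [q] by a tangent vector, and
    by [v /\ w], which acts as [v w + <v, w>]. *)
Definition cliff (q : pb_total Q) (v : tvector M) (w : Delta) : Delta :=
  clact kn (clvec (\col_i g (pb_proj Q q) v (frm q i))) w.

Definition cliff_wedge (q : pb_total Q) (v1 v2 : tvector M) (w : Delta) : Delta :=
  cliff q v1 (cliff q v2 w) + (g (pb_proj Q q) v1 v2)%:C%C *: w.

(** [kappa^m_{r*}(x y)] for [x, y] in the fiber of [F], given by their
    coordinates in the frame [auxmap q]. *)
Definition kappa_F (x y : 'cV[R]_r) (w : Delta) : Delta :=
  kappam kr (clvec x * clvec y) w.

Definition Theta (f : 'I_r -> pb_total PF -> 'cV[R]_r) (k l : 'I_r)
    (X Y : vfield M) (b : pb_total PF) : R :=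
  F_dot b (curvature DF X Y (f k) b) (f l b).

(** The action of the 2-form [Theta_kl]. *)
Definition Theta_act (e : 'I_n -> vfield M) (f : 'I_r -> pb_total PF -> 'cV[R]_r)
    (k l : 'I_r) (q : pb_total Q) (w : Delta) : Delta :=
  \sum_(i < n) \sum_(j < n | (i < j)%N)
    (Theta f k l (e i) (e j) (auxmap q))%:C%C *:
      cliff_wedge q (e i (pb_proj Q q)) (e j (pb_proj Q q)) w.

End SpinStructures.

(* Main.v *)
(** Fix [q] over [p].  Right translation of a smooth local section of the bundle
    [Q] gives a local section [s] through [q], hence orthonormal frames [u] of [TM]
    and [h] of [F], in which [DS] is [d + c(omega) + kappa(theta)], where
    [c(A) = 1/2 sum_{i<j} A_ij e_i e_j].  Since [c] intertwines commutators and
    since metric compatibility gives the structure equation, the curvature of [DS]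
    is [c(Omega) + kappa(Theta)] for the curvature matrices of [D] and [DF].
    Skew-symmetry of these matrices allows one to pass from [u], [h] to the given
    frames without differentiating the change of frame.  The contraction of
    [c(Omega)] reduces to the scalar curvature by the first Bianchi identity. *)

Require Import Defs.
From HB Require Import structures.
From mathcomp Require Import all_boot all_order all_algebra.
From mathcomp Require Import all_classical all_reals all_analysis.
From mathcomp Require Import complex.
From mathcomp Require Import ring.

Import Order.TTheory GRing.Theory Num.Theory.
Import numFieldNormedType.Exports.
Local Open Scope classical_set_scope.
Local Open Scope ring_scope.

Set Implicit Arguments.
Unset Strict Implicit.
Unset Printing Implicit Defensive.

(** * Smooth functions and tangent vectors *)

(** Vector fields, sections and connections are total functions constrained only over open sets, so
    identities are known only near a point, and locality must be derived before a second derivative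
    is taken. Indicator functions of an open set or of its complement serve for this, being smooth
    on that open set.

    The curvature is never shown to be tensorial in its section argument. It is replaced by the
    scalars <R(X,Y)s, t>: the second slot expands pointwise in any orthonormal frame, and
    skew-symmetry then brings the first slot into that position. One argument serves [TM] and [F],
    both being seen through the functions <s, t> along a local section of a map to [M].

    Origin of the constants: over all pairs of indices [c(Omega)] carries the factor 1/4. Averaging
    the three cyclic copies of its contraction leaves -2 times the Clifford contraction of Ricci,
    which is minus the scalar curvature because [e_i e_i = -1]; the product is 1/2. In the twisting
    term, the 1/2 in front of [Theta] is absorbed when the sum over all [i], [j] becomes the sum
    over [i < j] that defines a 2-form. *)

Section SmoothFunctions.
Context (R : realType) (n : nat).
Implicit Types (D : set 'rV[R]_n) (f g : 'rV[R]_n -> R) (vs : seq 'rV[R]_n).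

Lemma near_eq_continuous f g x : (\near x, f x = g x) ->
  {for x, continuous f} -> {for x, continuous g}.
Proof.
move=> e cf; have ex := nbhs_singleton e.
suff : g y @[y --> x] --> f x by rewrite ex.
exact: cvg_trans (near_eq_cvg e) cf.
Qed.

Lemma iter_derive_near D f g vs : open D -> (forall x, D x -> f x = g x) ->
  forall x, D x -> iter_derive vs f x = iter_derive vs g x.
Proof.
move=> oD fg; elim: vs => [//|v vs IH] x Dx /=.
apply: near_eq_derive.
by apply: filterS (open_nbhs_nbhs (conj oD Dx)) => y /IH.
Qed.

Lemma smooth_rV_eq D f g : open D -> (forall x, D x -> f x = g x) ->
  smooth_rV D f -> smooth_rV D g.
Proof.
move=> oD fg sf vs x Dx; have [cf df] := sf vs x Dx.
have e : \near x, iter_derive vs f x = iter_derive vs g x.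
  apply: filterS (open_nbhs_nbhs (conj oD Dx)) => y.
  exact: iter_derive_near.
by split; [apply: near_eq_continuous e cf|move=> v; apply: near_eq_derivable (df v)].
Qed.

Lemma smooth_rV_cst D (a : R) : smooth_rV D (fun=> a).
Proof.
have E vs : exists b : R, iter_derive vs (fun=> a) = cst b.
  elim: vs => [|v vs [b IH]] /=; first by exists a.
  by exists 0; apply/funext => x; rewrite IH derive_cst.
move=> vs x Dx; have [b ->] := E vs.
by split; [exact: cst_continuous|move=> v; apply: derivable_cst].
Qed.

Lemma iter_deriveD D f g vs : open D -> smooth_rV D f -> smooth_rV D g ->
  forall x, D x ->
  iter_derive vs (fun y => f y + g y) x = iter_derive vs f x + iter_derive vs g x.
Proof.
move=> oD sf sg; elim: vs => [//|v vs IH] x Dx /=.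
have [_ df] := sf vs x Dx; have [_ dg] := sg vs x Dx.
rewrite -deriveD //; apply: near_eq_derive.
by apply: filterS (open_nbhs_nbhs (conj oD Dx)) => y /IH.
Qed.

Lemma smooth_rVD D f g : open D -> smooth_rV D f -> smooth_rV D g ->
  smooth_rV D (fun x => f x + g x).
Proof.
move=> oD sf sg vs x Dx.
have [cf df] := sf vs x Dx; have [cg dg] := sg vs x Dx.
have e : \near x, iter_derive vs f x + iter_derive vs g x =
    iter_derive vs (fun y => f y + g y) x.
  by apply: filterS (open_nbhs_nbhs (conj oD Dx)) => y Dy; rewrite (@iter_deriveD D).
split; first exact: near_eq_continuous e (cvgD cf cg).
by move=> v; apply: near_eq_derivable e _; apply: derivableD.
Qed.

Lemma iter_derive_rcons vs v f :
  iter_derive (rcons vs v) f = iter_derive vs (fun x => 'D_v f x).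
Proof. by rewrite /iter_derive foldr_rcons. Qed.

Lemma smooth_rV_derive D f v : smooth_rV D f -> smooth_rV D (fun x => 'D_v f x).
Proof. by move=> sf vs x Dx; rewrite -iter_derive_rcons; apply: sf. Qed.

(** Induction on the number of directions. The innermost derivative is peeled off, so that
    [f D_v g + g D_v f] is again a sum of products of smooth functions, with fewer derivatives left
    to take. *)
Lemma smooth_rVM D f g : open D -> smooth_rV D f -> smooth_rV D g ->
  smooth_rV D (fun x => f x * g x).
Proof.
move=> oD sf sg vs.
have [k] := ubnP (size vs); elim: k vs f g sf sg => // k IH vs f g sf sg.
case/lastP: vs => [_ x|vs v].
  move=> Dx; have [cf df] := sf [::] x Dx; have [cg dg] := sg [::] x Dx.
  by split; [exact: (cvgM cf cg)|move=> v; exact: derivableM].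
rewrite size_rcons ltnS => sk x Dx.
rewrite iter_derive_rcons.
set F := fun x => f x * 'D_v g x; set G := fun x => g x * 'D_v f x.
have e y : D y -> F y + G y = 'D_v (fun x => f x * g x) y.
  move=> Dy; have [_ df] := sf [::] y Dy; have [_ dg] := sg [::] y Dy.
  by rewrite [RHS]deriveM.
have sF ws : (size ws < k)%N -> forall x, D x ->
   {for x, continuous (iter_derive ws F)} /\
     forall v, derivable (iter_derive ws F) x v.
  exact: (IH ws f (fun x => 'D_v g x) sf (smooth_rV_derive v sg)).
have sG ws : (size ws < k)%N -> forall x, D x ->
   {for x, continuous (iter_derive ws G)} /\
     forall v, derivable (iter_derive ws G) x v.
  exact: (IH ws g (fun x => 'D_v f x) sg (smooth_rV_derive v sf)).
(* [F] and [G] are so far differentiable only up to order [k], so additivity of iterated derivatives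
   is proved again within that bound. *)
have FG ws : (size ws <= k)%N -> forall x, D x ->
    iter_derive ws (fun x => F x + G x) x = iter_derive ws F x + iter_derive ws G x.
  elim: ws => [//|w ws IHw] /= sw y Dy.
  have [_ dF] := sF ws sw y Dy; have [_ dG] := sG ws sw y Dy.
  rewrite -deriveD //; apply: near_eq_derive.
  by apply: filterS (open_nbhs_nbhs (conj oD Dy)) => z /(IHw (ltnW sw)).
have E : \near x, iter_derive vs F x + iter_derive vs G x =
    iter_derive vs (fun x => 'D_v (fun x => f x * g x) x) x.
  apply: filterS (open_nbhs_nbhs (conj oD Dx)) => y Dy.
  rewrite -FG ?(ltnW sk) //.
  exact: (@iter_derive_near D (fun x => F x + G x) _ vs oD e).
have [cF dF] := sF _ sk _ Dx; have [cG dG] := sG _ sk _ Dx.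
split; first exact: near_eq_continuous E (cvgD cF cG).
by move=> w; apply: near_eq_derivable E _; apply: derivableD.
Qed.

(** The continuous inverse [cbwd] keeps points near [cfwd c p] inside [U], and [img_open] keeps them
    inside the image. This transports statements valid near a point of [M] to coordinates. *)
Lemma chart_image_open (M : topologicalType) (c : chart R n M) (U : set M) :
  open U -> open (cfwd c @` (cdom c `&` U)).
Proof.
move=> oU; rewrite openE => _ [p [cp Up] <-].
have oI := @img_open _ _ _ c.
have Ip : (cfwd c @` cdom c) (cfwd c p) by exists p.
have cb : {for cfwd c p, continuous (cbwd c)}.
  have := @bwd_continuous _ _ _ c; rewrite continuous_open_subspace //; apply.
  by rewrite inE.
have h : \forall x \near cfwd c p, U (cbwd c x).
  by apply: cb; rewrite fwdK //; apply: open_nbhs_nbhs.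
rewrite /interior; near=> x.
have [q cq qx] : (cfwd c @` cdom c) x by near: x; apply: open_nbhs_nbhs.
exists q => //; split=> //.
by rewrite -(fwdK cq) qx; near: x.
Unshelve. all: by end_near.
Qed.

End SmoothFunctions.

(** * Germs of functions, tangent vectors as derivations, and the Lie bracket *)

Section TangentVectors.
Context (R : realType) (n : nat) (M : manifold R n).
Implicit Types (U V W : set M) (p : M) (f h : M -> R) (v w : tvector M).
Implicit Types (X Y Z : vfield M).

Lemma smooth_fun_sub U V f : V `<=` U -> smooth_fun U f -> smooth_fun V f.
Proof.
move=> VU sf c ac vs x [p [cp Vp] <-]; apply: (sf c ac).
by exists p => //; split=> //; apply: VU.
Qed.

Lemma smooth_fun_eq U f h : open U -> (forall p, U p -> f p = h p) ->
  smooth_fun U f -> smooth_fun U h.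
Proof.
move=> oU fh sf c ac; apply: smooth_rV_eq (sf c ac); first exact: chart_image_open.
by move=> _ [p [cp Up] <-]; rewrite fwdK // fh.
Qed.

(** [smooth_fun] is a condition at each single point on a total function, so any set [W] containing
    the point will serve. *)
Lemma smooth_fun_local U f :
  (forall p, U p -> exists2 W : set M, W p & smooth_fun W f) -> smooth_fun U f.
Proof.
move=> h c ac vs x [p [cp Up] <-]; have [W Wp sf] := h p Up.
by apply: (sf c ac); exists p.
Qed.

Lemma smooth_fun_cst U (a : R) : smooth_fun U (fun=> a).
Proof. by move=> c _; apply: smooth_rV_cst. Qed.

Lemma smooth_funD U f h : open U -> smooth_fun U f -> smooth_fun U h ->
  smooth_fun U (fun p => f p + h p).
Proof.
move=> oU sf sh c ac; apply: smooth_rVD (sf c ac) (sh c ac).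
exact: chart_image_open.
Qed.

Lemma smooth_funM U f h : open U -> smooth_fun U f -> smooth_fun U h ->
  smooth_fun U (fun p => f p * h p).
Proof.
move=> oU sf sh c ac; apply: smooth_rVM (sf c ac) (sh c ac).
exact: chart_image_open.
Qed.

Lemma smooth_funZ U (a : R) f : open U -> smooth_fun U f ->
  smooth_fun U (fun p => a * f p).
Proof. by move=> oU; apply: (smooth_funM oU (@smooth_fun_cst U a)). Qed.

Lemma smooth_funN U f : open U -> smooth_fun U f -> smooth_fun U (fun p => - f p).
Proof.
move=> oU sf; apply: smooth_fun_eq (smooth_funZ (-1) oU sf) => // p _.
by rewrite mulN1r.
Qed.

Lemma smooth_funB U f h : open U -> smooth_fun U f -> smooth_fun U h ->
  smooth_fun U (fun p => f p - h p).
Proof. by move=> oU sf sh; apply: (smooth_funD oU sf (smooth_funN oU sh)). Qed.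

Lemma smooth_fun_sum U (I : Type) (s : seq I) (P : pred I) (F : I -> M -> R) :
  open U -> (forall i, P i -> smooth_fun U (F i)) ->
  smooth_fun U (fun p => \sum_(i <- s | P i) F i p).
Proof.
move=> oU sF; elim: s => [|i s IH].
  by rewrite (_ : (fun _ => _) = fun=> 0); [apply: smooth_fun_cst|apply/funext => p; rewrite big_nil].
case Pi: (P i).
  rewrite (_ : (fun _ => _) = fun p => F i p + \sum_(j <- s | P j) F j p).
    exact: (smooth_funD oU (sF i Pi) IH).
  by apply/funext => p; rewrite big_cons Pi.
rewrite (_ : (fun _ => _) = fun p => \sum_(j <- s | P j) F j p) //.
by apply/funext => p; rewrite big_cons Pi.
Qed.

Lemma smooth_nearP U p f : open U -> U p -> smooth_fun U f -> smooth_near p f.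
Proof. by move=> oU Up sf; exists U. Qed.

Lemma smooth_near2 p f h : smooth_near p f -> smooth_near p h ->
  exists U, [/\ open U, U p, smooth_fun U f & smooth_fun U h].
Proof.
move=> [U [oU Up sf]] [V [oV Vp sh]]; exists (U `&` V).
split; [exact: openI|by []|apply: smooth_fun_sub sf|apply: smooth_fun_sub sh].
- exact: subIsetl.
- exact: subIsetr.
Qed.

Lemma smooth_near_cst p (a : R) : smooth_near p (fun=> a).
Proof. by exists setT; split=> //; [exact: openT|exact: smooth_fun_cst]. Qed.

Lemma smooth_nearD p f h : smooth_near p f -> smooth_near p h ->
  smooth_near p (fun q => f q + h q).
Proof.
move=> sf sh; have [U [oU Up {}sf {}sh]] := smooth_near2 sf sh.
exact: (smooth_nearP oU Up (smooth_funD oU sf sh)).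
Qed.

Lemma smooth_nearM p f h : smooth_near p f -> smooth_near p h ->
  smooth_near p (fun q => f q * h q).
Proof.
move=> sf sh; have [U [oU Up {}sf {}sh]] := smooth_near2 sf sh.
exact: (smooth_nearP oU Up (smooth_funM oU sf sh)).
Qed.

Lemma smooth_nearN p f : smooth_near p f -> smooth_near p (fun q => - f q).
Proof.
by move=> [U [oU Up sf]]; apply: (smooth_nearP oU Up (smooth_funN oU sf)).
Qed.

Lemma smooth_nearB p f h : smooth_near p f -> smooth_near p h ->
  smooth_near p (fun q => f q - h q).
Proof. by move=> sf sh; apply: (smooth_nearD sf (smooth_nearN sh)). Qed.

Lemma nearP p (P : M -> Prop) : (\forall q \near p, P q) ->
  exists V, [/\ open V, V p & V `<=` P].
Proof.
by move=> h; have : nbhs p P := h; rewrite nbhsE => -[V [oV Vp] VP]; exists V.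
Qed.

Lemma smooth_near_eq p f h : (\forall q \near p, f q = h q) ->
  smooth_near p f -> smooth_near p h.
Proof.
move=> /nearP[V [oV Vp fh]] [U [oU Up sf]].
exists (U `&` V); split; [exact: openI|by []|].
apply: (@smooth_fun_eq _ f); [exact: openI|by move=> q [_ /fh]|].
by apply: smooth_fun_sub sf; apply: subIsetl.
Qed.

Section AtPoint.
Variables (p : M) (v : tvector M).
Hypothesis tv : tangent p v.

Lemma tangent_lin a f h : smooth_near p f -> smooth_near p h ->
  v (fun q => a * f q + h q) = a * v f + v h.
Proof. by case: tv => _ lin _; apply: lin. Qed.

Lemma tangentM f h : smooth_near p f -> smooth_near p h ->
  v (fun q => f q * h q) = v f * h p + f p * v h.
Proof. by case: tv => _ _ leib; apply: leib. Qed.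

Lemma tangentD f h : smooth_near p f -> smooth_near p h ->
  v (fun q => f q + h q) = v f + v h.
Proof.
move=> sf sh; rewrite -[v f]mul1r -(tangent_lin _ sf sh); congr (v _).
by apply/funext => q; rewrite mul1r.
Qed.

Lemma tangent_cst a : v (fun=> a) = 0.
Proof.
have s := @smooth_near_cst p.
have v0 : v (fun=> 0) = 0.
  apply: (addrI (v (fun=> 0))); rewrite addr0 -(tangentD (s 0) (s 0)).
  by congr (v _); apply/funext => q; rewrite addr0.
have v1 : v (fun=> 1) = 0.
  apply: (addrI (v (fun=> 1))); rewrite addr0.
  have e := tangentM (s 1) (s 1); rewrite [in LHS]mulr1 in e.
  by rewrite {3}e mulr1 mul1r.
by have := tangent_lin a (s 1) (s 0); rewrite mulr1 addr0 v0 v1 mulr0 addr0.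
Qed.

Lemma tangentZ a f : smooth_near p f -> v (fun q => a * f q) = a * v f.
Proof.
move=> sf; rewrite (tangentM (@smooth_near_cst p a) sf).
by rewrite tangent_cst mul0r add0r.
Qed.

Lemma tangentN f : smooth_near p f -> v (fun q => - f q) = - v f.
Proof.
move=> sf; rewrite -mulN1r -(tangentZ _ sf).
by congr (v _); apply/funext => q; rewrite mulN1r.
Qed.

Lemma tangentB f h : smooth_near p f -> smooth_near p h ->
  v (fun q => f q - h q) = v f - v h.
Proof. by move=> sf sh; rewrite (tangentD sf (smooth_nearN sh)) tangentN. Qed.

(** The indicator function of the complement of a neighbourhood [V] of [p] is
    smooth near [p], so no bump function is needed. *)
Lemma tangent_near f h : smooth_near p f -> (\forall q \near p, f q = h q) ->
  v f = v h.
Proof.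
move=> sf fh; have sh := smooth_near_eq fh sf.
apply/eqP; rewrite -subr_eq0 -(tangentB sf sh).
have [V [oV Vp {}fh]] := nearP fh.
pose k q : R := if q \in V then 0 else 1.
have kV q : V q -> k q = 0 by move=> Vq; rewrite /k mem_set.
have sk : smooth_near p k.
  apply: (@smooth_near_eq p (fun=> 0) k _ (@smooth_near_cst p 0)).
  by apply: (filterS _ (open_nbhs_nbhs (conj oV Vp))) => q /kV ->.
have -> : (fun q => f q - h q) = (fun q => (f q - h q) * k q).
  apply/funext => q; rewrite /k; case: ifPn => [|_]; last by rewrite mulr1.
  by rewrite inE => /fh ->; rewrite subrr mulr0.
by rewrite (tangentM (smooth_nearB sf sh) sk) kV // fh // subrr mulr0 mul0r addr0.
Qed.

End AtPoint.

Lemma tangent_scaleD p a v w : tangent p v -> tangent p w -> tangent p (a *: v + w).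
Proof.
move=> tv tw; have [v0 _ _] := tv; have [w0 _ _] := tw; split=> [f nf|b f h sf sh|f h sf sh].
- by rewrite /= /GRing.scale /= fctE [LHS]/= v0 // w0 // scaler0 addr0.
- rewrite !fctE /= !(tangent_lin tv, tangent_lin tw) // /GRing.scale /=; ring.
- rewrite !fctE /= !(tangentM tv, tangentM tw) // /GRing.scale /=; ring.
Qed.

Lemma tangent0 p : tangent p 0.
Proof.
by split=> [//|a f h _ _|f h _ _]; rewrite /= ?mulr0 ?mul0r addr0.
Qed.

Lemma vector_field_sub U V X : V `<=` U -> vector_field U X -> vector_field V X.
Proof.
move=> VU [tX sX]; split=> [p /VU /tX //|W f oW WV].
by apply: sX => //; apply: subset_trans VU.
Qed.

Lemma vector_field_lin U f X Y : open U -> smooth_fun U f ->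
  vector_field U X -> vector_field U Y ->
  vector_field U (fun p => f p *: X p + Y p).
Proof.
move=> oU sf [tX sX] [tY sY]; split=> [p Up|V h oV VU sh].
  by apply: tangent_scaleD; [apply: tX|apply: tY].
exact: (smooth_funD oV (smooth_funM oV (smooth_fun_sub VU sf) (sX V h oV VU sh)) (sY V h oV VU sh)).
Qed.

Lemma vector_field0 U : vector_field U (fun=> 0).
Proof. by split=> [p _|V f _ _ _]; [apply: tangent0|apply: smooth_fun_cst]. Qed.

Lemma vector_field_sum U (I : finType) (a : I -> R) (u : I -> vfield M) :
  open U -> (forall i, vector_field U (u i)) ->
  vector_field U (fun p => \sum_i a i *: u i p).
Proof.
move=> oU vu; elim: (index_enum I) => [|i s IH].
  by rewrite (_ : (fun _ => _) = fun=> 0); [apply: vector_field0|apply/funext => q; rewrite big_nil].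
rewrite (_ : (fun _ => _) = fun p => a i *: u i p + \sum_(j <- s) a j *: u j p).
  exact: (vector_field_lin oU (@smooth_fun_cst U (a i)) (vu i) IH).
by apply/funext => p; rewrite big_cons.
Qed.

Lemma vector_field_smooth_near U X p f : open U -> vector_field U X -> U p ->
  smooth_near p f -> smooth_near p (fun q => X q f).
Proof.
move=> oU [_ sX] Up [V [oV Vp sf]]; exists (U `&` V); split; [exact: openI|by []|].
apply: sX; [exact: openI|exact: subIsetl|].
by apply: smooth_fun_sub sf; apply: subIsetr.
Qed.

Lemma bracketE X Y p f : smooth_near p f ->
  bracket X Y p f = X p (fun q => Y q f) - Y p (fun q => X q f).
Proof. by move=> sf; rewrite /bracket; case: asboolP. Qed.

Lemma bracketNE X Y p f : ~ smooth_near p f -> bracket X Y p f = 0.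
Proof. by move=> sf; rewrite /bracket; case: asboolP. Qed.

Lemma near_smooth_near p f : smooth_near p f -> \forall q \near p, smooth_near q f.
Proof.
move=> [U [oU Up sf]]; apply: filterS (open_nbhs_nbhs (conj oU Up)) => q Uq.
by exists U.
Qed.

Lemma near_open U p : open U -> U p -> \forall q \near p, U q.
Proof. by move=> oU Up; apply: open_nbhs_nbhs. Qed.

(** The mixed terms [X f * Y h + Y f * X h] are symmetric in [X] and [Y] and cancel in the
    commutator. The rules for the inner field hold only at points near [p], hence the passage
    through [tangent_near]. *)
Lemma bracket_tangent U X Y p : open U -> vector_field U X -> vector_field U Y ->
  U p -> tangent p (bracket X Y p).
Proof.
move=> oU vX vY Up; have tX := vX.1 p Up; have tY := vY.1 p Up.
split=> [f /bracketNE //|a f h sf sh|f h sf sh].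
  have lin (Z T : vfield M) : vector_field U Z -> vector_field U T ->
      Z p (fun q => T q (fun x => a * f x + h x)) =
      a * Z p (fun q => T q f) + Z p (fun q => T q h).
    move=> vZ vT; have tZ := vZ.1 p Up.
    have sTf := vector_field_smooth_near oU vT Up sf.
    have sTh := vector_field_smooth_near oU vT Up sh.
    rewrite -(tangent_lin tZ a sTf sTh); apply: esym; apply: (tangent_near tZ).
      exact: (smooth_nearD (smooth_nearM (@smooth_near_cst p a) sTf) sTh).
    apply: filterS3 (near_open oU Up) (near_smooth_near sf) (near_smooth_near sh).
    move=> q Uq sfq shq.
    by rewrite (tangent_lin (vT.1 q Uq) a sfq shq).
  have sl : smooth_near p (fun x => a * f x + h x).
    exact: (smooth_nearD (smooth_nearM (@smooth_near_cst p a) sf) sh).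
  by rewrite (bracketE _ _ sl) (bracketE _ _ sf) (bracketE _ _ sh) !lin //; ring.
have leib (Z T : vfield M) : vector_field U Z -> vector_field U T ->
    Z p (fun q => T q (fun x => f x * h x)) =
    Z p (fun q => T q f) * h p + T p f * Z p h + (Z p f * T p h + f p * Z p (fun q => T q h)).
  move=> vZ vT; have tZ := vZ.1 p Up.
  have sTf := vector_field_smooth_near oU vT Up sf.
  have sTh := vector_field_smooth_near oU vT Up sh.
  rewrite -(tangentM tZ sTf sh) -(tangentM tZ sf sTh).
  rewrite -(tangentD tZ (smooth_nearM sTf sh) (smooth_nearM sf sTh)).
  apply: esym; apply: (tangent_near tZ).
    exact: (smooth_nearD (smooth_nearM sTf sh) (smooth_nearM sf sTh)).
  apply: filterS3 (near_open oU Up) (near_smooth_near sf) (near_smooth_near sh).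
  move=> q Uq sfq shq.
  by rewrite (tangentM (vT.1 q Uq) sfq shq).
rewrite (bracketE _ _ (smooth_nearM sf sh)) !leib // (bracketE _ _ sf) (bracketE _ _ sh).
by ring.
Qed.

Lemma bracket_vector_field U X Y : open U ->
  vector_field U X -> vector_field U Y -> vector_field U (bracket X Y).
Proof.
move=> oU vX vY; split=> [p|V f oV VU sf]; first exact: bracket_tangent oU vX vY.
apply: (@smooth_fun_eq V (fun p => X p (fun q => Y q f) - Y p (fun q => X q f)) _ oV).
  by move=> p Vp; rewrite (@bracketE X Y p f) //; exists V.
exact: (smooth_funB oV (vX.2 V _ oV VU (vY.2 V f oV VU sf)) (vY.2 V _ oV VU (vX.2 V f oV VU sf))).
Qed.

(** Written as multiplication by a constant function, the form to which [conn_scalel] applies. *)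
Lemma bracketC X Y : bracket X Y = fun p => - 1 *: bracket Y X p.
Proof.
apply/funext => p; apply/funext => f; rewrite /bracket /=.
rewrite /GRing.scale /= /GRing.scale /=; case: asboolP => _; rewrite ?mulr0 // mulN1r opprB //.
Qed.

(** Each double bracket expands into four third-order terms; each of the six orderings of [X], [Y],
    [Z] then occurs twice, with opposite signs. *)
Lemma jacobi U X Y Z p : open U -> vector_field U X -> vector_field U Y ->
  vector_field U Z -> U p ->
  bracket X (bracket Y Z) p + bracket Y (bracket Z X) p + bracket Z (bracket X Y) p = 0.
Proof.
move=> oU vX vY vZ Up; apply/funext => f; rewrite !fctE.
(* At a function that is not smooth near [p] all brackets take the default value 0. *)
have [sf|nf] := pselect (smooth_near p f); last by rewrite !bracketNE // !addr0.
have E (S T W : vfield M) : vector_field U S -> vector_field U T -> vector_field U W ->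
   bracket S (bracket T W) p f =
   S p (fun q => T q (fun x => W x f)) - S p (fun q => W q (fun x => T x f)) -
   (T p (fun q => W q (fun x => S x f)) - W p (fun q => T q (fun x => S x f))).
  move=> vS vT vW; have tS := vS.1 p Up.
  have sn (A : vfield M) (h : M -> R) : vector_field U A -> smooth_near p h ->
      smooth_near p (fun q => A q h).
    by move=> vA; apply: vector_field_smooth_near vA Up.
  rewrite (bracketE _ _ sf) (bracketE _ _ (sn S f vS sf)).
  have s1 := sn T _ vT (sn W f vW sf); have s2 := sn W _ vW (sn T f vT sf).
  congr (_ - _); rewrite -(tangentB tS s1 s2).
  apply: esym; apply: (tangent_near tS (smooth_nearB s1 s2)).
  apply: filterS (near_smooth_near sf) => q sq.
  by rewrite (bracketE _ _ sq).
rewrite !E // -[RHS]/(0 : R); ring.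
Qed.

End TangentVectors.

(** * Clifford algebras and spin groups *)

Section CliffordAlgebra.
Context (K : comNzRingType) (n : nat).
Implicit Types x y : clifford K n.

Lemma clscaleAl (a : K) x y : a *: (x * y) = a *: x * y.
Proof.
apply/ffunP => C; rewrite !ffunE scaler_sumr; apply: eq_bigr => A _.
by rewrite !ffunE /GRing.scale /=; ring.
Qed.

Lemma clscaleAr (a : K) x y : a *: (x * y) = x * (a *: y).
Proof.
apply/ffunP => C; rewrite !ffunE scaler_sumr; apply: eq_bigr => A _.
by rewrite !ffunE /GRing.scale /=; ring.
Qed.

HB.instance Definition _ :=
  GRing.Lmodule_isLalgebra.Build K (clifford K n) clscaleAl.
HB.instance Definition _ :=
  GRing.Lalgebra_isAlgebra.Build K (clifford K n) clscaleAr.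

End CliffordAlgebra.

(** Links the sums over [i < j], in which spin connections and 2-forms are written, to full double
    sums, which can be reindexed and carried through a change of frame. *)
Lemma sum_lt_half (R : numFieldType) (V : lmodType R) n (F : 'I_n -> 'I_n -> V) :
  (forall i, F i i = 0) -> (forall i j, F i j = F j i) ->
  \sum_(i < n) \sum_(j < n | (i < j)%N) F i j = 2^-1 *: \sum_i \sum_j F i j.
Proof.
move=> F0 FC; set S := LHS.
suff -> : \sum_i \sum_j F i j = S + S.
  by rewrite -[S + S]mulr2n -[S *+ 2]scaler_nat scalerA mulVf ?scale1r // pnatr_eq0.
have E : S = \sum_(i < n) \sum_(j < n | (j < i)%N) F i j.
  rewrite /S (exchange_big_dep xpredT) //=; apply: eq_bigr => i _.
  by apply: eq_bigr => j _.
rewrite {2}E -big_split /=; apply: eq_bigr => i _.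
rewrite (bigID (fun j : 'I_n => (i < j)%N)) /=; congr (_ + _).
rewrite (bigID (fun j : 'I_n => j == i)) /= big1 ?add0r => [|j /andP[_ /eqP->]//].
by apply: eq_bigl => j; rewrite -leqNgt ltn_neqAle andbC.
Qed.

(** The relations are kept abstract so that the identities also apply to the
    images of the generators under an orthogonal change of frame. *)
Section CliffordFamily.
Context (R : numFieldType) (A : algType R) (n : nat).
Implicit Types (E : 'I_n -> A) (B C W : 'M[R]_n).

Definition clifford_family E :=
  forall i j, E i * E j + E j * E i = (- (2 * (i == j)%:R)) *: 1.

Definition bivector E B : A :=
  2^-1 *: \sum_(i < n) \sum_(j < n | (i < j)%N) B i j *: (E i * E j).

Definition skew B := forall i j, B j i = - B i j.

Lemma skew0 B i : skew B -> B i i = 0.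
Proof. by move=> /(_ i i) /eqP; rewrite -addr_eq0 -mulr2n mulrn_eq0 /= => /eqP. Qed.

Lemma family_swap E i j : clifford_family E ->
  E j * E i = - (2 * (i == j)%:R) *: 1 - E i * E j.
Proof. by move=> /(_ i j) <-; rewrite addrC addKr. Qed.

(** Off the diagonal [B i j] and [E i * E j] are both skew, so their product is symmetric; the
    halving turns 1/2 into 1/4. *)
Lemma bivectorE E B : clifford_family E -> skew B ->
  bivector E B = 4^-1 *: \sum_i \sum_j B i j *: (E i * E j).
Proof.
move=> cE sB; rewrite /bivector sum_lt_half => [|i|i j].
- by rewrite scalerA -invfM -natrM.
- by rewrite skew0 // scale0r.
have [->//|ij] := eqVneq i j.
by rewrite [B j i]sB (@family_swap E i j) // (negPf ij) mulr0 oppr0 scale0r sub0r scaleNr scalerN opprK.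
Qed.

(** This is [lambda_{n*}]: the commutator with a bivector acts on the frame by the rows of [B]. The
    1/2 in [bivector] compensates the 2 in [lambda_{n*}(e_i e_j) = 2 E_ij]. *)
Lemma bivector_comm_gen E B k : clifford_family E -> skew B ->
  bivector E B * E k - E k * bivector E B = \sum_j B k j *: E j.
Proof.
move=> cE sB; rewrite bivectorE // -scalerAl -scalerAr -scalerBr.
rewrite mulr_suml mulr_sumr -sumrB.
(* From [x y z - z x y = x (y z + z y) - (x z + z x) y], in which only anticommutators are left. *)
have -> : \sum_i ((\sum_j B i j *: (E i * E j)) * E k - E k * \sum_j B i j *: (E i * E j)) =
   \sum_i \sum_j (B i j * (- (2 * (j == k)%:R))) *: E i
   - \sum_i \sum_j (B i j * (- (2 * (i == k)%:R))) *: E j.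
  rewrite -sumrB; apply: eq_bigr => i _.
  rewrite mulr_suml mulr_sumr -!sumrB; apply: eq_bigr => j _.
  rewrite -scalerAl -scalerAr -scalerBr -!scalerA -scalerBr; congr (_ *: _).
  have -> : - (2 * (j == k)%:R) *: E i = E i * (E j * E k + E k * E j).
    by rewrite cE -scalerAr mulr1.
  have -> : - (2 * (i == k)%:R) *: E j = (E i * E k + E k * E i) * E j.
    by rewrite cE -scalerAl mul1r.
  by rewrite mulrDr mulrDl !mulrA addrKA.
rewrite exchange_big (bigD1 k) //= [X in _ + X - _]big1 ?addr0 => [|j nk]; last first.
  by apply: big1 => i _; rewrite (negPf nk) mulr0 oppr0 mulr0 scale0r.
rewrite [X in _ - X](bigD1 k) //= [X in _ - (_ + X)]big1 ?addr0 => [|i nk]; last first.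
  by apply: big1 => j _; rewrite (negPf nk) mulr0 oppr0 mulr0 scale0r.
rewrite -sumrB scaler_sumr; apply: eq_bigr => j _.
rewrite eqxx sB -scalerBl scalerA; congr (_ *: _).
by rewrite /= mulr1n; field.
Qed.

(** The commutator with [bivector E B] is a derivation, hence determined on products [E k * E l] by
    its values on the frame. The products of matrices come out reversed because frames are acted on
    by rows. *)
Lemma bivector_commutator E B C : clifford_family E -> skew B -> skew C ->
  bivector E B * bivector E C - bivector E C * bivector E B =
  bivector E (C *m B - B *m C).
Proof.
move=> cE sB sC.
have sBC : skew (C *m B - B *m C).
  move=> i j; rewrite !mxE opprB -!sumrB; apply: eq_bigr => k _.
  by rewrite (sC k j) (sC i k) (sB k j) (sB i k); ring.
rewrite [in RHS]bivectorE // [bivector E C]bivectorE //.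
have := fun k => bivector_comm_gen k cE sB.
move: (bivector E B) => b bE; rewrite -scalerAl -scalerAr -scalerBr.
congr (_ *: _).
have D k l : b * (E k * E l) - E k * E l * b =
    (\sum_j B k j *: E j) * E l + E k * (\sum_j B l j *: E j).
  by rewrite -!bE mulrBl mulrBr !mulrA addrA subrK.
rewrite mulr_suml mulr_sumr -sumrB.
transitivity (\sum_k \sum_l (\sum_j (C k l * B k j) *: (E j * E l)
                + \sum_j (C k l * B l j) *: (E k * E j))).
  apply: eq_bigr => k _; rewrite mulr_suml mulr_sumr -sumrB; apply: eq_bigr => l _.
  rewrite -scalerAl -scalerAr -scalerBr D scalerDr mulr_suml mulr_sumr !scaler_sumr.
  by congr (_ + _); apply: eq_bigr => j _; rewrite -?scalerAl -?scalerAr scalerA.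
under eq_bigr => k _ do rewrite big_split /=.
rewrite big_split /=.
transitivity (\sum_i \sum_j ((C *m B) i j *: (E i * E j)) - \sum_i \sum_j ((B *m C) i j *: (E i * E j))); last first.
  rewrite -sumrB; apply: eq_bigr => i _; rewrite -sumrB; apply: eq_bigr => j _.
  by rewrite !mxE -scalerBl.
rewrite addrC; congr (_ + _).
  apply: eq_bigr => k _; rewrite exchange_big /=; apply: eq_bigr => j _.
  by rewrite mxE scaler_suml.
rewrite -sumrN; under eq_bigr => k _ do rewrite exchange_big /=.
rewrite exchange_big /=; apply: eq_bigr => j _; rewrite -sumrN exchange_big /=.
apply: eq_bigr => l _; rewrite mxE scaler_suml -sumrN; apply: eq_bigr => k _.
by rewrite (sB j k) mulrN scaleNr mulrC.
Qed.

Definition change_frame E (a : 'M[R]_n) i := \sum_k a i k *: E k.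

Lemma change_frame_family E a : clifford_family E -> a *m a^T = 1%:M ->
  clifford_family (change_frame E a).
Proof.
move=> cE oa i j; rewrite /change_frame.
have D u v : (\sum_k a u k *: E k) * (\sum_l a v l *: E l) =
     \sum_k \sum_l (a u k * a v l) *: (E k * E l).
  rewrite mulr_suml; apply: eq_bigr => k _; rewrite mulr_sumr; apply: eq_bigr => l _.
  by rewrite -scalerAl -scalerAr scalerA.
rewrite !D [X in _ + X]exchange_big -big_split /=.
have <- : (a *m a^T) i j = (i == j)%:R by rewrite oa mxE.
rewrite mxE mulr_sumr -sumrN scaler_suml; apply: eq_bigr => k _.
rewrite -big_split (bigD1 k) //= big1 ?addr0 => [|l nl].
  by rewrite [a j k * _]mulrC -scalerDr cE eqxx mulr1 scalerA mxE; congr (_ *: _); ring.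
by rewrite [a j l * _]mulrC -scalerDr cE eq_sym (negPf nl) mulr0 oppr0 scale0r scaler0.
Qed.

(** A bivector depends only on the skew endomorphism, whose matrix in the new frame is
    [a *m W *m a^T]. Both sides are taken as full sums, since the ordering [i < j] is not respected
    by a change of frame. *)
Lemma bivector_change_frame E a W : clifford_family E -> a *m a^T = 1%:M ->
  skew W -> bivector (change_frame E a) (a *m W *m a^T) = bivector E W.
Proof.
move=> cE oa sW.
have sT : skew (a *m W *m a^T).
  move=> i j; have tW : W^T = - W by apply/matrixP => k l; rewrite !mxE.
  have : (a *m W *m a^T)^T = - (a *m W *m a^T).
    by rewrite !trmx_mul trmxK tW mulNmx mulmxN mulmxA.
  by move=> /matrixP /(_ i j); rewrite !mxE.
rewrite !bivectorE //; last exact: change_frame_family.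
congr (_ *: _).
transitivity (\sum_i \sum_j \sum_k \sum_l ((a *m W *m a^T) i j * a i k * a j l) *: (E k * E l)).
  apply: eq_bigr => i _; apply: eq_bigr => j _; rewrite mulr_suml scaler_sumr.
  apply: eq_bigr => k _; rewrite mulr_sumr scaler_sumr; apply: eq_bigr => l _.
  by rewrite -scalerAl -scalerAr !scalerA.
have oa' : a^T *m a = 1%:M by apply: mulmx1C.
set V := a *m W *m a^T.
have -> : W = a^T *m V *m a by rewrite /V !mulmxA oa' mul1mx -mulmxA oa' mulmx1.
transitivity (\sum_k \sum_l \sum_i \sum_j (V i j * a i k * a j l) *: (E k * E l)).
  under eq_bigr => i _ do rewrite exchange_big /=.
  rewrite exchange_big /=; apply: eq_bigr => k _.
  under eq_bigr => i _ do rewrite exchange_big /=.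
  by rewrite exchange_big.
apply: eq_bigr => k _; apply: eq_bigr => l _.
rewrite exchange_big mxE scaler_suml; apply: eq_bigr => j _.
rewrite mxE mulr_suml scaler_suml; apply: eq_bigr => i _.
by rewrite [a^T k i]mxE [a i k * _]mulrC.
Qed.

Lemma sum_delta (V : lmodType R) (i : 'I_n) (F : 'I_n -> V) :
  \sum_a (a == i)%:R *: F a = F i.
Proof.
rewrite (bigD1 i) //= big1 => [|a /negPf->]; last by rewrite scale0r.
by rewrite eqxx scale1r addr0.
Qed.

(** One summand of the cyclic sum in [contract3]: [P] is the fourfold product, [u], [v], [w] are the
    twofold products left over by the swaps, [d1], [d2], [d3] the Kronecker symbols and [x], [y],
    [z] the cyclic values of [T]. *)
Let bianchi_collect (P u v w : A) (x y z d1 d2 d3 : R) : x + y + z = 0 ->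
  x *: P + (y *: P - (y * (2 * d1)) *: u + (y * (2 * d2)) *: v)
    + (z *: P - (z * (2 * d1)) *: u + (z * (2 * d3)) *: w) =
  (d1 * - (2 * (y + z))) *: u + (d2 * (2 * y)) *: v + (d3 * (2 * z)) *: w.
Proof.
move=> xyz; rewrite !addrA. rewrite [LHS](ACl ((1*2*5)*(3*6)*4*7)) /= -!scalerDl xyz scale0r add0r.
rewrite -![- (_ *: u)]scaleNr -scalerDl.
by congr (_ *: _ + _ *: _ + _ *: _); ring.
Qed.

(** * Clifford contraction of an algebraic curvature tensor *)

Section BianchiContraction.
Variables (E : 'I_n -> A) (T : 'I_n -> 'I_n -> 'I_n -> 'I_n -> R).
Hypotheses (cE : clifford_family E).
Hypotheses (skew12 : forall i j a b, T j i a b = - T i j a b).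
Hypotheses (skew34 : forall i j a b, T i j b a = - T i j a b).
Hypothesis bianchi : forall i j a b, T i j a b + T j a i b + T a i j b = 0.

(** With [T i j a b] read as <R(e_i,e_j)e_a, e_b>, this is the Ricci tensor, and its trace is the
    sum in [scalar_curvature]. *)
Let ric i b := \sum_j T i j j b.

Let T11 i a b : T i i a b = 0.
Proof. by apply/eqP; rewrite -[_ == 0](mulrn_eq0 _ 2) mulr2n {1}skew12 addNr. Qed.

(** The symmetry holds term by term: in the Bianchi identity for [i], [j], [b] paired with [j], the
    term [T b i j j] vanishes and the other two are the summands to be compared. *)
Let ricC i b : ric b i = ric i b.
Proof.
apply: eq_bigr => j _; have := bianchi i j b j.
rewrite [T b i j j](_ : _ = 0) ?addr0; last first.
  by apply/eqP; rewrite -[_ == 0](mulrn_eq0 _ 2) mulr2n {1}skew34 addNr.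
rewrite (skew34 i j j b) (skew12 b j i j) (skew34 b j j i) opprK.
by move/eqP; rewrite addrC subr_eq0 => /eqP.
Qed.

(** A symmetric tensor sees only the anticommutators of the [E i], that is, its trace. *)
Let ric_contract : \sum_i \sum_b ric i b *: (E i * E b) = - (\sum_i ric i i) *: 1.
Proof.
have -> : - (\sum_i ric i i) *: 1 =
    2^-1 *: \sum_i \sum_b ric i b *: (E i * E b + E b * E i).
  rewrite -sumrN scaler_suml scaler_sumr; apply: eq_bigr => i _.
  rewrite (bigD1 i) //= big1 ?addr0 => [|b nb]; last first.
    by rewrite cE eq_sym (negPf nb) mulr0 oppr0 scale0r scaler0.
  rewrite cE eqxx !scalerA mulr1; congr (_ *: _); by field.
under [in RHS]eq_bigr => i _ do (under eq_bigr => b _ do rewrite scalerDr; rewrite big_split /=).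
rewrite big_split /= [X in _ + X]exchange_big /=.
under [X in _ + X]eq_bigr => b _ do under eq_bigr => i _ do rewrite ricC.
by rewrite -mulr2n -[X in _ = _ *: X]scaler_nat scalerA mulVf ?scale1r // pnatr_eq0.
Qed.

Let S := \sum_i \sum_j \sum_a \sum_b T i j a b *: (E i * E j * E a * E b).

(** Three cyclic relabellings of [S] are brought to the common product [E i * E j * E a * E b],
    whose total coefficient vanishes by Bianchi. The Kronecker terms left by the swaps form three
    groups, each equal to [Q], so [3 S = 3 Q]. *)
Let contract3 : S = (- 2) *: \sum_i \sum_b ric i b *: (E i * E b).
Proof.
set Q := RHS.
have S2 : S = \sum_i \sum_j \sum_a \sum_b T j a i b *: (E j * E a * E i * E b).
  by rewrite [RHS]exchange_big; apply: eq_bigr => j _; rewrite exchange_big.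
have S3 : S = \sum_i \sum_j \sum_a \sum_b T a i j b *: (E a * E i * E j * E b).
  by rewrite S2 [RHS]exchange_big; apply: eq_bigr => j _; rewrite exchange_big.
have sw1 i j a : E j * E a * E i =
    E i * E j * E a - (2 * (a == i)%:R) *: E j + (2 * (i == j)%:R) *: E a.
  rewrite -mulrA (@family_swap E i a) // mulrBr -scalerAr mulr1 mulrA.
  rewrite (@family_swap E i j) // mulrBl -scalerAl mul1r [a == i]eq_sym.
  by rewrite !scaleNr opprB opprK addrA [X in X + _ = _]addrC.
have sw2 i j a : E a * E i * E j =
    E i * E j * E a - (2 * (a == i)%:R) *: E j + (2 * (j == a)%:R) *: E i.
  by rewrite sw1 sw1 addrK.
have s1 : \sum_i \sum_j \sum_a (a == i)%:R *: (\sum_b (- (2 * (T j a i b + T a i j b))) *: (E j * E b)) = Q.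
  transitivity (\sum_i \sum_j \sum_b (- (2 * T j i i b)) *: (E j * E b)).
    apply: eq_bigr => i _; apply: eq_bigr => j _.
    by rewrite sum_delta; apply: eq_bigr => b _; rewrite T11 addr0.
  rewrite exchange_big /Q scaler_sumr; apply: eq_bigr => j _.
  rewrite exchange_big scaler_sumr; apply: eq_bigr => b _.
  rewrite scalerA mulr_sumr scaler_suml; apply: eq_bigr => i _.
  by rewrite mulNr.
have s2 : \sum_i \sum_j (j == i)%:R *: (\sum_a \sum_b (2 * T j a i b) *: (E a * E b)) = Q.
  under eq_bigr => i _ do rewrite sum_delta.
  rewrite exchange_big /Q scaler_sumr; apply: eq_bigr => a _.
  rewrite exchange_big scaler_sumr; apply: eq_bigr => b _.
  rewrite scalerA mulr_sumr scaler_suml; apply: eq_bigr => i _.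
  by rewrite skew12 mulrN mulNr.
have s3 : \sum_i \sum_j \sum_a (a == j)%:R *: (\sum_b (2 * T a i j b) *: (E i * E b)) = Q.
  rewrite /Q scaler_sumr; apply: eq_bigr => i _.
  under eq_bigr => j _ do rewrite sum_delta.
  rewrite exchange_big scaler_sumr; apply: eq_bigr => b _.
  rewrite scalerA mulr_sumr scaler_suml; apply: eq_bigr => j _.
  by rewrite skew12 mulrN mulNr.
have D : S + S + S = Q + Q + Q.
  rewrite {2}S2 {2}S3 -{1}s1 -{1}s2 -s3 -!big_split; apply: eq_bigr => i _.
  rewrite -!big_split; apply: eq_bigr => j _ /=; rewrite scaler_sumr -!big_split.
  apply: eq_bigr => a _ /=; rewrite !scaler_sumr -!big_split; apply: eq_bigr => b _ /=.
  have -> : E j * E a * E i * E b = E i * E j * E a * E b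
      - (2 * (a == i)%:R) *: (E j * E b) + (2 * (i == j)%:R) *: (E a * E b).
    by rewrite sw1 mulrDl mulrBl -!scalerAl.
  have -> : E a * E i * E j * E b = E i * E j * E a * E b
      - (2 * (a == i)%:R) *: (E j * E b) + (2 * (j == a)%:R) *: (E i * E b).
    by rewrite sw2 mulrDl mulrBl -!scalerAl.
  rewrite !scalerDr !scalerN !scalerA [j == i]eq_sym [a == j]eq_sym.
  exact: bianchi_collect.
have three (x : A) : 3^-1 *: (x + x + x) = x.
  rewrite (_ : x + x + x = 3%:R *: x); last by rewrite scaler_nat !mulrS addr0 addrA.
  by rewrite scalerA mulVf ?pnatr_eq0 // scale1r.
by rewrite -(three S) D three.
Qed.

(** The constant is 1/4 from [bivectorE], times -2 from [contract3], times -1 from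
    [ric_contract]. *)
Lemma bianchi_contraction :
  \sum_i \sum_j E i * E j * bivector E (\matrix_(a, b) T i j a b) =
  (2^-1 * \sum_i \sum_j T i j j i) *: 1.
Proof.
have -> : (2^-1 * \sum_i \sum_j T i j j i) *: (1 : A) = 4^-1 *: S.
  rewrite contract3 ric_contract !scalerA; congr (_ *: _).
  by rewrite /ric; field.
rewrite scaler_sumr; apply: eq_bigr => i _; rewrite scaler_sumr; apply: eq_bigr => j _.
rewrite bivectorE // => [|a b]; last by rewrite !mxE.
rewrite -scalerAr; congr (_ *: _); rewrite mulr_sumr; apply: eq_bigr => a _.
rewrite mulr_sumr; apply: eq_bigr => b _.
by rewrite mxE -scalerAr !mulrA.
Qed.

End BianchiContraction.
End CliffordFamily.

(** Two block-triangular factorizations of one block matrix; this serves to compute the determinant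
    of a reflection. *)
Lemma det_1_sub_mulmx (R : comNzRingType) n (u : 'cV[R]_n) (w : 'rV[R]_n) :
  \det (1%:M - u *m w) = 1 - (w *m u) 0 0.
Proof.
have d1 : \det (block_mx 1%:M u w (1%:M : 'M[R]_1)) = \det (1%:M - u *m w).
  have -> : block_mx 1%:M u w (1%:M : 'M[R]_1) =
      block_mx (1%:M - u *m w) u 0 (1%:M : 'M[R]_1) *m block_mx 1%:M 0 w 1%:M.
    by rewrite mulmx_block !(mulmx1, mulmx0, mul0mx, mul1mx, add0r, subrK).
  by rewrite det_mulmx det_ublock det_lblock !det1 !mulr1.
rewrite -d1; have -> : block_mx 1%:M u w (1%:M : 'M[R]_1) =
    block_mx 1%:M 0 w (1%:M : 'M[R]_1) *m block_mx 1%:M u 0 (1%:M - w *m u).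
  by rewrite mulmx_block !(mulmx1, mulmx0, mul0mx, mul1mx, add0r, addr0, (addrC (w *m u)), subrK).
by rewrite det_mulmx det_ublock det_lblock !det1 !mul1r det_mx11 !mxE.
Qed.

(** * Spin groups and the covering of the special orthogonal group *)

Section SpinGroup.
Context (R : realType) (n : nat).
Implicit Types (v w : 'cV[R]_n) (x y : clifford R n) (s : seq 'cV[R]_n).

Lemma clgen_family : clifford_family (@clgen R n).
Proof. by move=> i j; rewrite clgen_anticomm. Qed.

Lemma clvec_lin a v w : clvec (a *: v + w) = a *: clvec v + clvec w.
Proof.
rewrite /clvec scaler_sumr -big_split; apply: eq_bigr => i _.
by rewrite !mxE scalerDl scalerA.
Qed.

Lemma clvecZ a v : clvec (a *: v) = a *: clvec v.
Proof.
by rewrite /clvec scaler_sumr; apply: eq_bigr => i _; rewrite mxE scalerA.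
Qed.

Definition dotcv v w : R := \sum_i v i 0 * w i 0.

Lemma clvec_anticomm v w :
  clvec v * clvec w + clvec w * clvec v = (- (2 * dotcv v w)) *: 1.
Proof.
have D v' w' : clvec v' * clvec w' =
     \sum_k \sum_l (v' k 0 * w' l 0) *: (clgen R k * clgen R l).
  rewrite mulr_suml; apply: eq_bigr => k _; rewrite mulr_sumr; apply: eq_bigr => l _.
  by rewrite -scalerAl -scalerAr scalerA.
rewrite !D [X in _ + X]exchange_big -big_split /=.
rewrite mulr_sumr -sumrN scaler_suml; apply: eq_bigr => k _.
rewrite -big_split (bigD1 k) //= big1 ?addr0 => [|l nl].
  by rewrite [w k 0 * _]mulrC -scalerDr clgen_family eqxx mulr1 scalerA; congr (_ *: _); ring.
by rewrite [w l 0 * _]mulrC -scalerDr clgen_family eq_sym (negPf nl) mulr0 oppr0 scale0r scaler0.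
Qed.

Lemma dotcv_unit v : \sum_i v i 0 ^+ 2 = 1 -> dotcv v v = 1.
Proof. by move=> <-; apply: eq_bigr => i _; rewrite expr2. Qed.

Lemma clvec_unit v : \sum_i v i 0 ^+ 2 = 1 -> clvec v * clvec v = - 1.
Proof.
move=> v1; apply: (@scalerI _ _ (2 : R)); first by rewrite pnatr_eq0.
rewrite scaler_nat mulr2n clvec_anticomm scalerN -scaleNr; congr (_ *: _).
by rewrite dotcv_unit // mulr1.
Qed.

Lemma tr_mul_cv v w : v^T *m w = (dotcv v w)%:M.
Proof.
apply/matrixP => i j; rewrite !ord1 !mxE eqxx mulr1n.
by apply: eq_bigr => k _; rewrite mxE.
Qed.

(** For unit [v], minus the reflection in the hyperplane orthogonal to [v]: the untwisted
    conjugation of [is_lambda] fixes [v] and negates its orthogonal complement. *)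
Definition reflmx v : 'M[R]_n := 2 *: (v *m v^T) - 1%:M.

Lemma reflmx_mul v w : reflmx v *m w = (2 * dotcv v w) *: v - w.
Proof.
rewrite mulmxBl mul1mx -scalemxAl -mulmxA -scalerA; congr (_ *: _ - _).
by rewrite tr_mul_cv mul_mx_scalar.
Qed.

Lemma reflmx_lambda v w : \sum_i v i 0 ^+ 2 = 1 ->
  clvec v * clvec w = clvec (reflmx v *m w) * clvec v.
Proof.
move=> v1; rewrite reflmx_mul -[- w]scaleN1r addrC clvec_lin scaleN1r.
rewrite clvecZ mulrDl -scalerAl clvec_unit // scalerN -scaleNr -clvec_anticomm mulNr.
by rewrite addrCA addNr addr0.
Qed.

Lemma reflmx_orth v : \sum_i v i 0 ^+ 2 = 1 -> (reflmx v)^T *m reflmx v = 1%:M.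
Proof.
move=> v1; have -> : (reflmx v)^T = reflmx v.
  by rewrite /reflmx linearB /= linearZ /= trmx_mul trmxK tr_scalar_mx.
have PP : (v *m v^T) *m (v *m v^T) = v *m v^T.
  by rewrite mulmxA -[_ *m v^T *m v]mulmxA tr_mul_cv dotcv_unit // mulmx1.
rewrite /reflmx mulmxBl mul1mx mulmxBr mulmx1 -scalemxAl -scalemxAr PP.
by rewrite [2 *: (_ *: _)]scaler_nat opprB mulr2n addrK addrC subrK.
Qed.

(** Of the eigenvalues, one is 1 and the other [n - 1] are -1; the exponent [n + 1] gives the same
    sign. *)
Lemma reflmx_det v : \sum_i v i 0 ^+ 2 = 1 -> \det (reflmx v) = (-1) ^+ n.+1.
Proof.
move=> v1; have -> : reflmx v = -1 *: (1%:M - (2 *: v) *m v^T).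
  by rewrite -scalemxAl scaleN1r opprB.
rewrite detZ det_1_sub_mulmx exprSr; congr (_ * _).
rewrite -scalemxAr tr_mul_cv dotcv_unit // !mxE eqxx mulr1n.
by ring.
Qed.

Definition unit_seq s := forall v, v \in s -> \sum_i v i 0 ^+ 2 = 1.

Lemma unit_seq_cons v s : unit_seq (v :: s) ->
  \sum_i v i 0 ^+ 2 = 1 /\ unit_seq s.
Proof.
move=> us; split=> [|w ws]; apply: us; rewrite inE ?eqxx //.
by rewrite ws orbT.
Qed.

Lemma prod_lambda s : unit_seq s -> exists A : 'M[R]_n,
  [/\ A^T *m A = 1%:M, \det A = (-1) ^+ (n.+1 * size s) &
      is_lambda (\prod_(v <- s) clvec v) A].
Proof.
elim: s => [_|v s IH /unit_seq_cons[v1 /IH[A [oA dA lA]]]].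
  exists 1%:M; rewrite trmx1 mulmx1 det1 muln0; split=> // w.
  by rewrite big_nil mul1mx mul1r mulr1.
exists (reflmx v *m A); split=> [||w].
- by rewrite trmx_mul mulmxA -[A^T *m _ *m _]mulmxA reflmx_orth // mulmx1.
- by rewrite det_mulmx reflmx_det // dA mulnS exprD.
by rewrite big_cons -mulrA lA mulrA reflmx_lambda // -!mulrA mulmxA.
Qed.

(** [frm_act] and [aux_act] speak of a given matrix of [lambda_n x], so one has to be produced. An
    even number of factors makes its determinant 1. *)
Lemma spin_lambda x : spin x -> exists2 A, SO A & is_lambda x A.
Proof.
move=> [s [es us] ->]; have [A [oA dA lA]] := prod_lambda us.
exists A => //; split=> //; rewrite dA -signr_odd oddM (negPf es) andbF //.
Qed.

Lemma spinM x y : spin x -> spin y -> spin (x * y).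
Proof.
move=> [s [es us] ->] [t [et ut] ->]; exists (s ++ t); last by rewrite big_cat.
split; first by rewrite size_cat oddD (negPf es) (negPf et).
by move=> v; rewrite mem_cat => /orP[/us|/ut].
Qed.

(** The product collapses from the middle outwards, each pair [v v] giving -1. For even length the
    reversed product is thus the inverse. *)
Lemma prod_rev s : unit_seq s ->
  (\prod_(v <- s) clvec v) * (\prod_(v <- rev s) clvec v) = (-1) ^+ size s.
Proof.
elim: s => [|v s IH /unit_seq_cons[v1 /IH e]]; first by rewrite !big_nil mulr1.
rewrite rev_cons big_cons big_rcons /= -mulrA [X in _ * X]mulrA e.
by rewrite mulrA commr_sign -mulrA clvec_unit // mulrN1 exprS mulN1r.
Qed.

Lemma spin_inv x : spin x -> exists2 y, spin y & x * y = 1.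
Proof.
move=> [s [es us] ->]; exists (\prod_(v <- rev s) clvec v).
  exists (rev s) => //; rewrite size_rev; split=> // v; rewrite mem_rev; exact: us.
by rewrite prod_rev // -signr_odd (negPf es).
Qed.

End SpinGroup.

(** * The actions of both Clifford algebras on spinors *)

Lemma clcomplexM (R : realType) n (x y : clifford R n) :
  clcomplex (x * y) = clcomplex x * clcomplex y.
Proof.
apply/ffunP => D; rewrite !ffunE rmorph_sum; apply: eq_bigr => A _.
rewrite !ffunE !rmorphM /=; congr (_ * _).
rewrite /clsign rmorph_prod; apply: eq_bigr => i _.
by rewrite rmorph_prod; apply: eq_bigr => j _; rewrite rmorph_sign.
Qed.

Lemma clcomplex_lin (R : realType) n (a : R) (x y : clifford R n) :
  clcomplex (a *: x + y) = a%:C%C *: clcomplex x + clcomplex y.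
Proof.
by apply/ffunP => D; rewrite !ffunE rmorphD rmorphM.
Qed.

Section SpinorAction.
Context (R : realType) (n r m : nat).
Local Notation C := (R[i]).
Local Notation Delta := (spinor R n r m).

Lemma act_leftM (A B : 'M[C]_(2 ^ n./2)) (w : Delta) :
  act_left (A *m B) w = act_left A (act_left B w).
Proof.
apply/ffunP => t; rewrite !ffunE.
under eq_bigr => i _ do rewrite mxE mulr_suml.
rewrite exchange_big; apply: eq_bigr => j _.
rewrite ffunE mulr_sumr; apply: eq_bigr => i _ /=.
by rewrite mulrA.
Qed.

Lemma act_left_linl (a : C) (A B : 'M[C]_(2 ^ n./2)) (w : Delta) :
  act_left (a *: A + B) w = a *: act_left A w + act_left B w.
Proof.
apply/ffunP => t; rewrite !ffunE scaler_sumr -big_split; apply: eq_bigr => i _.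
by rewrite !mxE mulrDl -mulrA.
Qed.

Lemma act_left_linr (a : C) (A : 'M[C]_(2 ^ n./2)) (u w : Delta) :
  act_left A (a *: u + w) = a *: act_left A u + act_left A w.
Proof.
apply/ffunP => t; rewrite !ffunE scaler_sumr -big_split; apply: eq_bigr => i _.
by rewrite !ffunE mulrDr /GRing.scale /=; ring.
Qed.

Lemma act_rightM (a : 'I_m) (A B : 'M[C]_(2 ^ r./2)) (w : Delta) :
  act_right a (A *m B) w = act_right a A (act_right a B w).
Proof.
apply/ffunP => t; rewrite !ffunE.
under eq_bigr => i _ do rewrite mxE mulr_suml.
rewrite exchange_big; apply: eq_bigr => j _.
rewrite ffunE mulr_sumr; apply: eq_bigr => i _ /=.
rewrite mulrA ffunE eqxx; congr (_ * _ * w (_, _)).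
by apply/ffunP => b; rewrite !ffunE; case: eqP.
Qed.

Lemma act_right_linl (a : 'I_m) (c : C) (A B : 'M[C]_(2 ^ r./2)) (w : Delta) :
  act_right a (c *: A + B) w = c *: act_right a A w + act_right a B w.
Proof.
apply/ffunP => t; rewrite !ffunE scaler_sumr -big_split; apply: eq_bigr => i _.
by rewrite !mxE mulrDl -mulrA.
Qed.

Lemma act_right_linr (a : 'I_m) (c : C) (A : 'M[C]_(2 ^ r./2)) (u w : Delta) :
  act_right a A (c *: u + w) = c *: act_right a A u + act_right a A w.
Proof.
apply/ffunP => t; rewrite !ffunE scaler_sumr -big_split; apply: eq_bigr => i _.
by rewrite !ffunE mulrDr /GRing.scale /=; ring.
Qed.

Lemma act_right_comm (a b : 'I_m) (A B : 'M[C]_(2 ^ r./2)) (w : Delta) :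
  a != b -> act_right a A (act_right b B w) = act_right b B (act_right a A w).
Proof.
move=> ab; apply/ffunP => t; rewrite !ffunE.
under eq_bigr => i _ do rewrite ffunE mulr_sumr.
under [RHS]eq_bigr => i _ do rewrite ffunE mulr_sumr.
rewrite exchange_big; apply: eq_bigr => j _; apply: eq_bigr => i _ /=.
rewrite !ffunE (negPf ab) eq_sym (negPf ab) !mulrA [B _ _ * _]mulrC.
congr (_ * w (_, _)); apply/ffunP => c; rewrite !ffunE.
case: eqP => // ->; case: eqP => // e; by rewrite e eqxx in ab.
Qed.

Lemma act_left_right (a : 'I_m) (A : 'M[C]_(2 ^ n./2)) (B : 'M[C]_(2 ^ r./2))
    (w : Delta) :
  act_left A (act_right a B w) = act_right a B (act_left A w).
Proof.
apply/ffunP => t; rewrite !ffunE.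
under eq_bigr => i _ do rewrite ffunE mulr_sumr.
under [RHS]eq_bigr => i _ do rewrite ffunE mulr_sumr.
rewrite exchange_big; apply: eq_bigr => j _; apply: eq_bigr => i _ /=.
by rewrite !mulrA [B _ _ * _]mulrC.
Qed.

Lemma act_tensor_linr (c : C) (A : 'M[C]_(2 ^ n./2)) (B : 'M[C]_(2 ^ r./2))
    (u w : Delta) :
  act_tensor A B (c *: u + w) = c *: act_tensor A B u + act_tensor A B w.
Proof.
apply/ffunP => t; rewrite !ffunE scaler_sumr -big_split; apply: eq_bigr => i _.
rewrite scaler_sumr -big_split; apply: eq_bigr => k _.
by rewrite !ffunE mulrDr /GRing.scale /=; ring.
Qed.

Variables (kn : spinor_rep R n) (kr : spinor_rep R r).

Lemma clactM (x y : clifford R n) (w : Delta) :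
  clact kn (x * y) w = clact kn x (clact kn y w).
Proof. by rewrite /clact clcomplexM (kappa_morph kn).2 -mulmxE act_leftM. Qed.

Lemma clact_linl (a : R) (x y : clifford R n) (w : Delta) :
  clact kn (a *: x + y) w = a%:C%C *: clact kn x w + clact kn y w.
Proof. by rewrite /clact clcomplex_lin linearP act_left_linl. Qed.

Lemma clact_linr (c : C) (x : clifford R n) (u w : Delta) :
  clact kn x (c *: u + w) = c *: clact kn x u + clact kn x w.
Proof. exact: act_left_linr. Qed.

Lemma clactDr (x : clifford R n) (u w : Delta) :
  clact kn x (u + w) = clact kn x u + clact kn x w.
Proof. by have := clact_linr 1 x u w; rewrite !scale1r. Qed.

Lemma clact1 (w : Delta) : clact kn 1 w = w.
Proof.
have -> : clact kn 1 w = act_left 1%:M w.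
  rewrite /clact; congr act_left.
  have -> : clcomplex 1 = 1 :> clifford C n.
    by apply/ffunP => A; rewrite !ffunE; case: (A == _).
  by rewrite (kappa_morph kn).1.
apply/ffunP => -[i k]; rewrite ffunE (bigD1 i) //= big1 => [|j nj].
  by rewrite mxE eqxx mul1r addr0.
by rewrite mxE eq_sym (negPf nj) mul0r.
Qed.

Lemma kappam_linl (a : R) (x y : clifford R r) (w : Delta) :
  kappam kr (a *: x + y) w = a%:C%C *: kappam kr x w + kappam kr y w.
Proof.
rewrite /kappam scaler_sumr -big_split; apply: eq_bigr => b _.
by rewrite clcomplex_lin linearP act_right_linl.
Qed.

Lemma kappam_linr (c : C) (x : clifford R r) (u w : Delta) :
  kappam kr x (c *: u + w) = c *: kappam kr x u + kappam kr x w.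
Proof.
rewrite /kappam scaler_sumr -big_split; apply: eq_bigr => b _.
exact: act_right_linr.
Qed.

Lemma kappamDr (x : clifford R r) (u w : Delta) :
  kappam kr x (u + w) = kappam kr x u + kappam kr x w.
Proof. by have := kappam_linr 1 x u w; rewrite !scale1r. Qed.

Lemma act_right_sum (a : 'I_m) (A : 'M[C]_(2 ^ r./2)) (F : 'I_m -> Delta) :
  act_right a A (\sum_b F b) = \sum_b act_right a A (F b).
Proof.
elim/big_rec2: _ => [|b u v _ <-]; last by rewrite -[F b]scale1r act_right_linr !scale1r.
by apply/ffunP => t; rewrite !ffunE big1 // => i _; rewrite ffunE mulr0.
Qed.

Lemma act_left_sum (A : 'M[C]_(2 ^ n./2)) (F : 'I_m -> Delta) :
  act_left A (\sum_b F b) = \sum_b act_left A (F b).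
Proof.
elim/big_rec2: _ => [|b u v _ <-]; last by rewrite -[F b]scale1r act_left_linr !scale1r.
by apply/ffunP => t; rewrite !ffunE big1 // => i _; rewrite ffunE mulr0.
Qed.

Lemma clact_kappam (x : clifford R n) (y : clifford R r) (w : Delta) :
  clact kn x (kappam kr y w) = kappam kr y (clact kn x w).
Proof.
by rewrite /clact /kappam act_left_sum; apply: eq_bigr => b _; rewrite act_left_right.
Qed.

(** Being a sum over tensor factors, [kappam] respects commutators but not products: actions on
    different factors commute and cancel, and on a common factor [kappa] is multiplicative. *)
Lemma kappam_comm (x y : clifford R r) (w : Delta) :
  kappam kr x (kappam kr y w) - kappam kr y (kappam kr x w) =
  kappam kr (x * y - y * x) w.
Proof.
have E z t : kappam kr z (kappam kr t w) =
   \sum_(a < m) \sum_(b < m)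
     act_right a (kr (clcomplex z)) (act_right b (kr (clcomplex t)) w).
  by apply: eq_bigr => a _; rewrite act_right_sum.
rewrite !E [X in _ - X]exchange_big -sumrB; apply: eq_bigr => a _.
rewrite -sumrB (bigD1 a) //= big1 ?addr0 => [|b nb].
  rewrite [x * y - _]addrC -[- (y * x)]scaleN1r clcomplex_lin linearP !clcomplexM.
  rewrite !(kappa_morph kr).2 -!mulmxE act_right_linl !act_rightM.
  by rewrite rmorphN1 scaleN1r addrC.
by rewrite act_right_comm ?subrr // eq_sym.
Qed.

End SpinorAction.

(** * Metric connections *)

(** Here [pi] is the identity of [M] for [TM] and the projection of the principal
    bundle for [F]; [sg] is a local section of [pi], along which the values of
    sections are compared. *)
Section MetricConnection.
Context (R : realType) (n : nat) (M : manifold R n).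
Variables (B : Type) (V : lmodType R) (pi : B -> M).
Variables (Gamma : set M -> set (B -> V)) (dot : B -> V -> V -> R).
Variable D : vfield M -> (B -> V) -> B -> V.
Variables (U : set M) (sg : M -> B).
Implicit Types (X Y : vfield M) (s t u : B -> V) (p : M).

Definition ip s t p := dot (sg p) (s (sg p)) (t (sg p)).

Hypothesis oU : open U.
Hypothesis connD : is_connection pi Gamma D.
Hypothesis metricD : metric_connection pi Gamma dot D.
Hypothesis sgK : forall p, U p -> pi (sg p) = p.
Hypothesis dot_inv : forall s t, Gamma U s -> Gamma U t ->
  forall b, U (pi b) -> ip s t (pi b) = dot b (s b) (t b).
Hypothesis ip_smooth : forall s t, Gamma U s -> Gamma U t -> smooth_fun U (ip s t).
Hypothesis ipC : forall s t, Gamma U s -> Gamma U t ->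
  forall p, U p -> ip s t p = ip t s p.
(** The three-term shape is that of [curvature]; closure of [Gamma] under differences is not among
    the assumptions. *)
Hypothesis ipB : forall s t u w, Gamma U s -> Gamma U t -> Gamma U u -> Gamma U w ->
  forall p, U p -> ip (fun b => s b - t b - u b) w p = ip s w p - ip t w p - ip u w p.

Local Notation vf := (vector_field U).

Let conn X s : vf X -> Gamma U s -> Gamma U (D X s).
Proof. by move=> vX Gs; apply: (conn_section connD). Qed.

Lemma metric_eq X s t p (h : M -> R) : vf X -> Gamma U s -> Gamma U t -> U p ->
  (forall q, U q -> h q = ip s t q) ->
  X p h = ip (D X s) t p + ip s (D X t) p.
Proof.
move=> vX Gs Gt Up hE; rewrite -{1}(sgK Up).
apply: (metricD oU vX Gs Gt); last by rewrite sgK.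
by move=> b Ub; rewrite hE // dot_inv.
Qed.

Lemma ip_curvatureC X Y s t p : vf X -> vf Y -> Gamma U s -> Gamma U t -> U p ->
  ip (curvature D Y X s) t p = - ip (curvature D X Y s) t p.
Proof.
move=> vX vY Gs Gt Up; have vXY := bracket_vector_field oU vX vY.
have vYX := bracket_vector_field oU vY vX.
set w := D (bracket X Y) s; have Gw : Gamma U w by apply: conn.
have N : ip (D (bracket Y X) s) t p = - ip w t p.
  (* The value [- w] is written as [w - w - w], the shape to which [ipB] applies. *)
  transitivity (ip (fun b => w b - w b - w b) t p); last by rewrite ipB // subrr sub0r.
  rewrite /ip subrr sub0r bracketC.
  rewrite (conn_scalel connD oU (@smooth_fun_cst _ _ M U (-1)) vXY Gs) ?sgK //.
  by rewrite scaleN1r.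
rewrite ![ip (curvature _ _ _ _) _ _]ipB //; [|by do 2?apply: (conn)..].
by rewrite N; ring.
Qed.

Lemma ip_curvature X Y s t p : vf X -> vf Y -> Gamma U s -> Gamma U t -> U p ->
  ip (curvature D X Y s) t p =
  X p (ip (D Y s) t) - Y p (ip (D X s) t) - ip (D (bracket X Y) s) t p
  - ip (D Y s) (D X t) p + ip (D X s) (D Y t) p.
Proof.
move=> vX vY Gs Gt Up; have vXY := bracket_vector_field oU vX vY.
rewrite [LHS]ipB //; [|by do 2?apply: (conn)..].
rewrite (@metric_eq X (D Y s) t p (ip (D Y s) t)) //; last exact: conn.
rewrite (@metric_eq Y (D X s) t p (ip (D X s) t)) //; last exact: conn.
by ring.
Qed.

(** The operator [X Y - Y X - [X, Y]] annihilates the function <s, t>. Expanding by metric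
    compatibility, the terms <D_X s, D_Y t> and <D_Y s, D_X t> cancel, and the two curvature terms
    remain. *)
Lemma curvature_skew X Y s t p : vf X -> vf Y -> Gamma U s -> Gamma U t -> U p ->
  ip (curvature D X Y t) s p = - ip (curvature D X Y s) t p.
Proof.
move=> vX vY Gs Gt Up; have vXY := bracket_vector_field oU vX vY.
have sst := ip_smooth Gs Gt; have nst := smooth_nearP oU Up sst.
apply/eqP; rewrite -addr_eq0; apply/eqP; rewrite !ip_curvature //.
have E Z T : vf Z -> vf T ->
    Z p (ip (D T t) s) + Z p (ip (D T s) t) = Z p (fun q => T q (ip s t)).
  move=> vZ vT; have tZ := vZ.1 p Up.
  have s1 := smooth_nearP oU Up (ip_smooth (conn vT Gt) Gs).
  have s2 := smooth_nearP oU Up (ip_smooth (conn vT Gs) Gt).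
  rewrite -(tangentD tZ s1 s2); apply: (tangent_near tZ (smooth_nearD s1 s2)).
  apply: filterS (near_open oU Up) => q Uq.
  rewrite (@metric_eq T s t q (ip s t)) // addrC; congr (_ + _).
  by apply: ipC => //; apply: conn.
have := bracketE X Y nst.
rewrite (@metric_eq _ s t p (ip s t)) // -!E //.
rewrite (@ipC s (D (bracket X Y) t)) //; last exact: conn.
rewrite (@ipC (D Y t) (D X s)) ?(@ipC (D X t) (D Y s)) //; [|exact: conn..].
move/eqP; rewrite -subr_eq0 => /eqP e; rewrite -[RHS]oppr0 -e; ring.
Qed.

Variables (k : nat) (u : 'I_k -> B -> V).
Hypothesis Gu : forall i, Gamma U (u i).
Hypothesis ip_frame : forall i j p, U p -> ip (u i) (u j) p = (i == j)%:R.
Hypothesis parseval : forall s t p, Gamma U s -> Gamma U t -> U p ->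
  ip s t p = \sum_l ip s (u l) p * ip t (u l) p.

Definition conn_form X p : 'M[R]_k := \matrix_(i, j) ip (D X (u i)) (u j) p.

Definition curv_form X Y p : 'M[R]_k :=
  \matrix_(i, j) ip (curvature D X Y (u i)) (u j) p.

Lemma conn_form_skew X p : vf X -> U p -> skew (conn_form X p).
Proof.
move=> vX Up i j; rewrite !mxE; apply/eqP; rewrite -addr_eq0 addrC.
rewrite (@ipC (D X (u j))) //; last exact: conn.
rewrite -(@metric_eq X (u i) (u j) p (fun=> (i == j)%:R)) //.
  by rewrite (tangent_cst (vX.1 p Up)).
by move=> q Uq; rewrite ip_frame.
Qed.

Lemma conn_form_smooth X i j : vf X -> smooth_fun U (fun p => conn_form X p i j).
Proof.
move=> vX; rewrite (_ : (fun _ => _) = ip (D X (u i)) (u j)).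
  by apply: ip_smooth => //; apply: conn.
by apply/funext => p; rewrite mxE.
Qed.

Lemma curv_form_skew X Y p : vf X -> vf Y -> U p -> skew (curv_form X Y p).
Proof. by move=> vX vY Up i j; rewrite !mxE curvature_skew. Qed.

(** Cartan's equation for the row convention [D u_i = sum_l omega_il u_l], with the products in the
    order given by [bivector_commutator]. It comes from differentiating <D_Y u_i, u_j>; the
    quadratic terms are the products <D u_i, D u_j> rewritten by [parseval] and skewness. *)
Lemma structure_equation X Y p i j : vf X -> vf Y -> U p ->
  curv_form X Y p i j =
  X p (fun q => conn_form Y q i j) - Y p (fun q => conn_form X q i j)
  - conn_form (bracket X Y) p i j
  + (conn_form Y p *m conn_form X p - conn_form X p *m conn_form Y p) i j.
Proof.
move=> vX vY Up; have vXY := bracket_vector_field oU vX vY.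
have E Z : (fun q => conn_form Z q i j) = ip (D Z (u i)) (u j).
  by apply/funext => q; rewrite mxE.
rewrite !E [LHS]mxE ip_curvature // [conn_form (bracket _ _) _ _ _]mxE -addrA.
congr (_ + _).
have F Z T : vf Z -> vf T ->
    (conn_form Z p *m conn_form T p) i j = - ip (D Z (u i)) (D T (u j)) p.
  move=> vZ vT; rewrite mxE parseval //; [|exact: conn..].
  rewrite -sumrN; apply: eq_bigr => l _.
  by rewrite (@conn_form_skew T p vT Up j l) [conn_form T p j l]mxE mxE mulrN.
by rewrite [RHS]mxE [X in _ = _ + X]mxE !F // opprK.
Qed.

(** [parseval] resolves the second slot into the frame [u]; after exchanging the slots by
    [curvature_skew] it resolves the other one. The entries of [a] are needed only at the point
    [p]. *)
Lemma curvature_change_frame X Y (e : 'I_k -> B -> V) p : vf X -> vf Y ->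
  (forall i, Gamma U (e i)) -> U p ->
  let a := \matrix_(i, l) ip (e i) (u l) p in
  \matrix_(i, j) ip (curvature D X Y (e i)) (e j) p = a *m curv_form X Y p *m a^T.
Proof.
move=> vX vY Ge Up a; have vXY := bracket_vector_field oU vX vY.
have P s t : Gamma U s -> Gamma U t -> ip (curvature D X Y s) t p =
    \sum_l ip (curvature D X Y s) (u l) p * ip t (u l) p.
  move=> Gs Gt.
  (* [parseval] speaks of sections, so it is applied to each of the three terms and not to the
     curvature itself. *)
  have C w : Gamma U w -> ip (curvature D X Y s) w p = ip (D X (D Y s)) w p -
      ip (D Y (D X s)) w p - ip (D (bracket X Y) s) w p.
    by move=> Gw; apply: ipB => //; do 2?apply: (conn).
  rewrite C //; under eq_bigr => l _ do rewrite C // !mulrBl.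
  by rewrite !sumrB -!parseval //; do 2?apply: (conn).
apply/matrixP => i j; rewrite mxE P // mxE; apply: eq_bigr => l _.
rewrite [a^T l j]mxE [a j l]mxE; congr (_ * _).
rewrite curvature_skew // P // -sumrN mxE; apply: eq_bigr => h _.
by rewrite [a i h]mxE mxE (@curvature_skew X Y (u h) (u l)) // mulNr opprK mulrC.
Qed.

Lemma frame_orth (e : 'I_k -> B -> V) p : (forall i, Gamma U (e i)) -> U p ->
  (forall i j, ip (e i) (e j) p = (i == j)%:R) ->
  let a := \matrix_(i, l) ip (e i) (u l) p in a *m a^T = 1%:M.
Proof.
move=> Ge Up oe a; apply/matrixP => i j; rewrite !mxE -oe parseval //.
by apply: eq_bigr => l _; rewrite !mxE.
Qed.

End MetricConnection.

(** * Locality and the first Bianchi identity for the Levi-Civita connection *)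

Section LeviCivita.
Context (R : realType) (n : nat) (M : manifold R n) (g : metric M).
Variables (D : vfield M -> vfield M -> vfield M) (LC : levi_civita g D).
Implicit Types (X Y Z : vfield M) (U : set M).

(** Multiplied by the indicator function [k] of [U], the fields [Y] and [Z] become equal as total
    functions. By the Leibniz rule [k] does not affect the derivative at [p], where it is locally
    1. *)
Lemma connection_local U X Y Z p : open U -> vector_field U X ->
  vector_field U Y -> vector_field U Z -> U p -> (forall q, U q -> Y q = Z q) ->
  D X Y p = D X Z p.
Proof.
have [cD _ _] := LC; move=> oU vX vY vZ Up YZ.
pose k q : R := if q \in U then 1 else 0.
have kU q : U q -> k q = 1 by move=> Uq; rewrite /k mem_set.
have sk : smooth_fun U k.
  by apply: smooth_fun_eq (@smooth_fun_cst _ _ M U 1) => // q /kU.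
have kE T : vector_field U T -> D X (fun q => k q *: T q) p = D X T p.
  move=> vT; rewrite (conn_leibniz cD oU vX sk vT Up) kU // scale1r.
  rewrite (_ : X p k = 0) ?scale0r ?add0r //.
  rewrite -(tangent_cst (vX.1 p Up) 1).
  apply: (tangent_near (vX.1 p Up) (smooth_nearP oU Up sk)).
  by apply: filterS (near_open oU Up) => q /kU.
rewrite -kE // -[RHS]kE //; congr (D X _ p); apply/funext => q.
by rewrite /k; case: ifPn => [|_]; [rewrite inE => /YZ ->|rewrite !scale0r].
Qed.

(** Vanishing torsion, used twice, gives [D_S D_T W = [S,[T,W]] + D_[T,W] S + D_S D_W T]. In the
    cyclic sum the last two kinds of terms cancel against the rest of the curvature, which leaves
    the Jacobi identity. *)
Lemma first_bianchi U X Y Z p : open U -> vector_field U X ->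
  vector_field U Y -> vector_field U Z -> U p ->
  curvature D X Y Z p + curvature D Y Z X p + curvature D Z X Y p = 0.
Proof.
have [cD _ tor] := LC; move=> oU vX vY vZ Up.
have T S T W : vector_field U S -> vector_field U T -> vector_field U W ->
    D S (D T W) p =
    bracket S (bracket T W) p + D (bracket T W) S p + D S (D W T) p.
  move=> vS vT vW; have vTW := bracket_vector_field oU vT vW.
  have vWT := conn_section cD oU vW vT.
  have := tor U S _ oU vS vTW p Up; move/eqP; rewrite subr_eq => /eqP e.
  rewrite -e -(conn_addr cD oU vS vTW vWT Up).
  (* The torsion identity for [T] and [W] holds on [U] only, so it enters under [D S] by
     locality. *)
  apply: (connection_local oU vS (conn_section cD oU vT vW) _ Up).
    have := vector_field_lin oU (@smooth_fun_cst _ _ M U 1) vTW vWT.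
    by rewrite (_ : (fun _ => _) = bracket T W + D W T) //; apply/funext => q; rewrite scale1r.
  move=> q Uq; have := tor U T W oU vT vW q Uq => /eqP; rewrite subr_eq => /eqP ->.
  by [].
have J := jacobi oU vX vY vZ Up.
rewrite /curvature (T X Y Z) // (T Y Z X) // (T Z X Y) // -J.
apply/funext => f; rewrite !fctE.
by ring.
Qed.

End LeviCivita.

(** * Derivatives of spinors and the curvature of [nabla^theta] *)

Section ComplexDerivative.
Context (R : realType) (n : nat) (M : manifold R n).
Local Notation C := (R[i]).
Local Notation Re := complex.Re.
Local Notation Im := complex.Im.
Implicit Types (p : M) (v : tvector M) (f h : M -> C).

Lemma cReD (x y : C) : Re (x + y) = Re x + Re y.
Proof. by case: x; case: y. Qed.

Lemma cImD (x y : C) : Im (x + y) = Im x + Im y.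
Proof. by case: x; case: y. Qed.

Lemma cReM (x y : C) : Re (x * y) = Re x * Re y - Im x * Im y.
Proof. by case: x; case: y. Qed.

Lemma cImM (x y : C) : Im (x * y) = Re x * Im y + Im x * Re y.
Proof. by case: x; case: y. Qed.

Definition csmooth U f := smooth_fun U (fun q => Re (f q)) /\ smooth_fun U (fun q => Im (f q)).

Definition csmooth_near p f :=
  smooth_near p (fun q => Re (f q)) /\ smooth_near p (fun q => Im (f q)).

Definition cderive v f : C := (v (fun q => Re (f q)) +i* v (fun q => Im (f q)))%C.

Lemma csmooth_nearP U p f : open U -> U p -> csmooth U f -> csmooth_near p f.
Proof. by move=> oU Up [s1 s2]; split; [exact: smooth_nearP s1|exact: smooth_nearP s2]. Qed.

Lemma csmooth_cst U c : csmooth U (fun=> c).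
Proof. by split; apply: smooth_fun_cst. Qed.

Lemma csmooth_real U (a : M -> R) : smooth_fun U a -> csmooth U (fun q => (a q)%:C%C).
Proof. by move=> sa; split; [exact: sa|exact: smooth_fun_cst]. Qed.

Lemma csmoothD U f h : open U -> csmooth U f -> csmooth U h ->
  csmooth U (fun q => f q + h q).
Proof.
move=> oU [f1 f2] [h1 h2]; split.
  rewrite (_ : (fun _ => _) = fun q => Re (f q) + Re (h q)); first exact: (smooth_funD oU f1 h1).
  by apply/funext => q; rewrite cReD.
rewrite (_ : (fun _ => _) = fun q => Im (f q) + Im (h q)); first exact: (smooth_funD oU f2 h2).
by apply/funext => q; rewrite cImD.
Qed.

Lemma csmoothM U f h : open U -> csmooth U f -> csmooth U h ->
  csmooth U (fun q => f q * h q).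
Proof.
move=> oU [f1 f2] [h1 h2]; split.
  rewrite (_ : (fun _ => _) = fun q => Re (f q) * Re (h q) - Im (f q) * Im (h q)).
    exact: (smooth_funB oU (smooth_funM oU f1 h1) (smooth_funM oU f2 h2)).
  by apply/funext => q; rewrite cReM.
rewrite (_ : (fun _ => _) = fun q => Re (f q) * Im (h q) + Im (f q) * Re (h q)).
  exact: (smooth_funD oU (smooth_funM oU f1 h2) (smooth_funM oU f2 h1)).
by apply/funext => q; rewrite cImM.
Qed.

Lemma csmooth_sum U (I : Type) (s : seq I) (P : pred I) (F : I -> M -> C) :
  open U -> (forall i, P i -> csmooth U (F i)) ->
  csmooth U (fun q => \sum_(i <- s | P i) F i q).
Proof.
move=> oU sF; elim: s => [|i s IH].
  by rewrite (_ : (fun _ => _) = fun=> 0); [apply: csmooth_cst|apply/funext => p; rewrite big_nil].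
case Pi: (P i).
  rewrite (_ : (fun _ => _) = fun p => F i p + \sum_(j <- s | P j) F j p).
    exact: (csmoothD oU (sF i Pi) IH).
  by apply/funext => p; rewrite big_cons Pi.
rewrite (_ : (fun _ => _) = fun p => \sum_(j <- s | P j) F j p) //.
by apply/funext => p; rewrite big_cons Pi.
Qed.

Lemma csmooth_eq U f h : open U -> (forall p, U p -> f p = h p) ->
  csmooth U f -> csmooth U h.
Proof.
move=> oU fh [f1 f2]; split.
  by apply: smooth_fun_eq oU _ f1 => p /fh ->.
by apply: smooth_fun_eq oU _ f2 => p /fh ->.
Qed.

Section AtPoint.
Variables (U : set M) (p : M) (v : tvector M).
Hypotheses (oU : open U) (Up : U p) (tv : tangent p v).

Let near f : csmooth U f ->
  smooth_near p (fun q => Re (f q)) /\ smooth_near p (fun q => Im (f q)).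
Proof. exact: csmooth_nearP. Qed.

Lemma cderive_cst c : cderive v (fun=> c) = 0.
Proof. by rewrite /cderive !(tangent_cst tv). Qed.

Lemma cderive_real (a : M -> R) : cderive v (fun q => (a q)%:C%C) = (v a)%:C%C.
Proof. by rewrite /cderive /= (tangent_cst tv). Qed.

Lemma cderiveD f h : csmooth U f -> csmooth U h ->
  cderive v (fun q => f q + h q) = cderive v f + cderive v h.
Proof.
move=> /near[f1 f2] /near[h1 h2]; rewrite /cderive.
have -> : (fun q => Re (f q + h q)) = (fun q => Re (f q) + Re (h q)).
  by apply/funext => q; rewrite cReD.
have -> : (fun q => Im (f q + h q)) = (fun q => Im (f q) + Im (h q)).
  by apply/funext => q; rewrite cImD.
by rewrite (tangentD tv f1 h1) (tangentD tv f2 h2).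
Qed.

Lemma cderiveM f h : csmooth U f -> csmooth U h ->
  cderive v (fun q => f q * h q) = cderive v f * h p + f p * cderive v h.
Proof.
move=> /near[f1 f2] /near[h1 h2]; rewrite /cderive.
have -> : (fun q => Re (f q * h q)) = (fun q => Re (f q) * Re (h q) - Im (f q) * Im (h q)).
  by apply/funext => q; rewrite cReM.
have -> : (fun q => Im (f q * h q)) = (fun q => Re (f q) * Im (h q) + Im (f q) * Re (h q)).
  by apply/funext => q; rewrite cImM.
rewrite (tangentB tv (smooth_nearM f1 h1) (smooth_nearM f2 h2)).
rewrite (tangentD tv (smooth_nearM f1 h2) (smooth_nearM f2 h1)).
rewrite (tangentM tv f1 h1) (tangentM tv f2 h2) (tangentM tv f1 h2) (tangentM tv f2 h1).
case: (f p) => a b; case: (h p) => c d /=.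
by apply/eqP; rewrite eq_complex /=; apply/andP; split; apply/eqP; ring.
Qed.

Lemma cderive_sum (I : Type) (s : seq I) (P : pred I) (F : I -> M -> C) :
  (forall i, P i -> csmooth U (F i)) ->
  cderive v (fun q => \sum_(i <- s | P i) F i q) = \sum_(i <- s | P i) cderive v (F i).
Proof.
move=> sF; elim: s => [|i s IH].
  rewrite [RHS]big_nil -[RHS](cderive_cst 0); congr (cderive v _).
  by apply/funext => q; rewrite big_nil.
rewrite big_cons -IH; case Pi: (P i); last first.
  by congr (cderive v _); apply/funext => q; rewrite big_cons Pi.
rewrite -(cderiveD (sF i Pi) (csmooth_sum s oU sF)).
by congr (cderive v _); apply/funext => q; rewrite big_cons Pi.
Qed.

Lemma cderive_local f h : csmooth U f -> (forall q, U q -> f q = h q) ->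
  cderive v f = cderive v h.
Proof.
move=> /near[f1 f2] fh; rewrite /cderive.
congr (_ +i* _)%C; apply: (tangent_near tv) => //.
  by apply: filterS (near_open oU Up) => q /fh ->.
by apply: filterS (near_open oU Up) => q /fh ->.
Qed.

End AtPoint.

Lemma csmooth_cderive U (X : vfield M) f : open U -> vector_field U X ->
  csmooth U f -> csmooth U (fun q => cderive (X q) f).
Proof. by move=> oU [_ sX] [f1 f2]; split; apply: sX. Qed.

Lemma cderive_bracket U (X Y : vfield M) f p : open U -> U p -> csmooth U f ->
  cderive (bracket X Y p) f =
  cderive (X p) (fun q => cderive (Y q) f) - cderive (Y p) (fun q => cderive (X q) f).
Proof.
move=> oU Up /(csmooth_nearP oU Up)[f1 f2].
by rewrite {1}/cderive (bracketE _ _ f1) (bracketE _ _ f2).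
Qed.

End ComplexDerivative.

(** * Differentiation of spinor-valued functions *)

Section SpinorDerivative.
Context (R : realType) (n r m : nat) (M : manifold R n).
Local Notation C := (R[i]).
Local Notation Delta := (spinor R n r m).
Implicit Types (p : M) (U : set M) (v : tvector M) (w : M -> Delta).

Definition sp_smooth U w := forall t, csmooth U (fun q => w q t).

Lemma spinor_deriveE v w t : spinor_derive v w t = cderive v (fun q => w q t).
Proof. by rewrite ffunE. Qed.

Lemma sp_smoothD U u w : open U -> sp_smooth U u -> sp_smooth U w ->
  sp_smooth U (fun q => u q + w q).
Proof.
move=> oU su sw t; apply: csmooth_eq oU _ (csmoothD oU (su t) (sw t)) => q _.
by rewrite ffunE.
Qed.

Lemma sp_smoothZ U (a : M -> R) w : open U -> smooth_fun U a -> sp_smooth U w ->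
  sp_smooth U (fun q => (a q)%:C%C *: w q).
Proof.
move=> oU sa sw t; apply: csmooth_eq oU _ (csmoothM oU (csmooth_real sa) (sw t)) => q _.
by rewrite ffunE.
Qed.

Lemma sp_smooth_sum U (I : Type) (s : seq I) (P : pred I) (F : I -> M -> Delta) :
  open U -> (forall i, P i -> sp_smooth U (F i)) ->
  sp_smooth U (fun q => \sum_(i <- s | P i) F i q).
Proof.
move=> oU sF t.
have := @csmooth_sum _ _ M U I s P (fun i q => F i q t) oU (fun i Pi => sF i Pi t).
by apply: csmooth_eq => // q _; rewrite sum_ffunE.
Qed.

Lemma sp_smooth_derive U (X : vfield M) w : open U -> vector_field U X ->
  sp_smooth U w -> sp_smooth U (fun q => spinor_derive (X q) w).
Proof.
move=> oU vX sw t; apply: csmooth_eq oU _ (csmooth_cderive oU vX (sw t)) => q _.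
by rewrite spinor_deriveE.
Qed.

Definition sp_linear (T : Delta -> Delta) := forall (c : C) (u w : Delta),
  T (c *: u + w) = c *: T u + T w.

Definition sp_delta (t : 'I_(2 ^ n./2) * {ffun 'I_m -> 'I_(2 ^ r./2)}) : Delta :=
  [ffun t' => (t' == t)%:R].

Lemma sp_decomp (w : Delta) : w = \sum_t w t *: sp_delta t.
Proof.
apply/ffunP => t; rewrite sum_ffunE (bigD1 t) //= big1 => [|t' nt].
  by rewrite !ffunE eqxx addr0 [RHS]mulr1.
by rewrite !ffunE eq_sym (negPf nt) [LHS]mulr0.
Qed.

Lemma sp_linear0 T : sp_linear T -> T 0 = 0.
Proof. by move=> lT; have := lT (-1) 0 0; rewrite scaler0 addr0 scaleN1r addNr. Qed.

Lemma sp_linearZ T c (w : Delta) : sp_linear T -> T (c *: w) = c *: T w.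
Proof. by move=> lT; rewrite -[c *: w]addr0 lT sp_linear0 // addr0. Qed.

Lemma sp_linear_sum T (I : Type) (s : seq I) (P : pred I) (F : I -> Delta) :
  sp_linear T -> T (\sum_(i <- s | P i) F i) = \sum_(i <- s | P i) T (F i).
Proof.
move=> lT; elim/big_rec2: _ => [|i u w _ <-]; first exact: sp_linear0.
by rewrite -[F i]scale1r lT !scale1r.
Qed.

Lemma sp_linearE T (w : Delta) t : sp_linear T ->
  T w t = \sum_t' T (sp_delta t') t * w t'.
Proof.
move=> lT; rewrite {1}[w]sp_decomp sp_linear_sum // sum_ffunE.
by apply: eq_bigr => t' _; rewrite sp_linearZ // ffunE mulrC.
Qed.

Lemma sp_smooth_linear U T w : open U -> sp_linear T -> sp_smooth U w ->
  sp_smooth U (fun q => T (w q)).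
Proof.
move=> oU lT sw t.
have := @csmooth_sum _ _ M U _ (index_enum _) xpredT
  (fun t' q => T (sp_delta t') t * w q t') oU
  (fun t' _ => csmoothM oU (csmooth_cst U (T (sp_delta t') t)) (sw t')).
by apply: csmooth_eq => // q _; rewrite [RHS]sp_linearE.
Qed.

Section AtPoint.
Variables (U : set M) (p : M) (v : tvector M).
Hypotheses (oU : open U) (Up : U p) (tv : tangent p v).

Lemma spinor_derive_local u w : sp_smooth U u -> (forall q, U q -> u q = w q) ->
  spinor_derive v u = spinor_derive v w.
Proof.
move=> su uw; apply/ffunP => t; rewrite !spinor_deriveE.
by apply: (cderive_local oU Up tv (su t)) => q /uw ->.
Qed.

Lemma spinor_deriveD u w : sp_smooth U u -> sp_smooth U w ->
  spinor_derive v (fun q => u q + w q) = spinor_derive v u + spinor_derive v w.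
Proof.
move=> su sw; apply/ffunP => t; rewrite [RHS]ffunE !spinor_deriveE.
rewrite -(cderiveD oU Up tv (su t) (sw t)); congr (cderive v _).
by apply/funext => q; rewrite ffunE.
Qed.

Lemma spinor_deriveZ (a : M -> R) w : smooth_fun U a -> sp_smooth U w ->
  spinor_derive v (fun q => (a q)%:C%C *: w q) =
  (v a)%:C%C *: w p + (a p)%:C%C *: spinor_derive v w.
Proof.
move=> sa sw; apply/ffunP => t; rewrite !ffunE -!/(cderive v (fun q => _ t)).
rewrite -(cderive_real tv) -(cderiveM oU Up tv (csmooth_real sa) (sw t)).
by congr (cderive v _); apply/funext => q; rewrite ffunE.
Qed.

Lemma spinor_derive_sum (I : Type) (s : seq I) (P : pred I) (F : I -> M -> Delta) :
  (forall i, P i -> sp_smooth U (F i)) ->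
  spinor_derive v (fun q => \sum_(i <- s | P i) F i q) =
  \sum_(i <- s | P i) spinor_derive v (F i).
Proof.
move=> sF; apply/ffunP => t; rewrite sum_ffunE spinor_deriveE.
under [RHS]eq_bigr => i _ do rewrite spinor_deriveE.
rewrite -(@cderive_sum _ _ M U p v oU Up tv I s P (fun i q => F i q t)); last first.
  by move=> i Pi; apply: sF.
by congr (cderive v _); apply/funext => q; rewrite sum_ffunE.
Qed.

(** In coordinates a linear map is a sum with constant coefficients, so the derivation passes
    through it. *)
Lemma spinor_derive_linear T w : sp_linear T -> sp_smooth U w ->
  spinor_derive v (fun q => T (w q)) = T (spinor_derive v w).
Proof.
move=> lT sw; apply/ffunP => t; rewrite [RHS]sp_linearE // spinor_deriveE.
transitivity (cderive v (fun q => \sum_t' T (sp_delta t') t * w q t')).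
  by congr (cderive v _); apply/funext => q; rewrite sp_linearE.
have sc t' : csmooth U (fun=> T (sp_delta t') t) by apply: csmooth_cst.
rewrite (cderive_sum oU Up tv); last by move=> t' _; apply: (csmoothM oU (sc t') (sw t')).
apply: eq_bigr => t' _.
by rewrite (cderiveM oU Up tv (sc t') (sw t')) (cderive_cst tv) mul0r add0r spinor_deriveE.
Qed.

End AtPoint.

Section Representation.
(** [act] stands for both [clact kn] and [kappam kr]; what they share is linearity in each argument,
    since [kappam] is not multiplicative. *)
Variables (N : nat) (act : clifford R N -> Delta -> Delta).
Hypothesis act_linl : forall a x y (w : Delta),
  act (a *: x + y) w = a%:C%C *: act x w + act y w.
Hypothesis act_linr : forall x, sp_linear (act x).

Lemma act0l (w : Delta) : act 0 w = 0.
Proof.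
by have := act_linl (-1) 0 0 w; rewrite scaler0 addr0 rmorphN1 scaleN1r addNr.
Qed.

Lemma act_suml (I : Type) (s : seq I) (P : pred I) (c : I -> R) F (w : Delta) :
  act (\sum_(i <- s | P i) c i *: F i) w =
  \sum_(i <- s | P i) (c i)%:C%C *: act (F i) w.
Proof.
by elim/big_rec2: _ => [|i x y _ <-]; rewrite ?act0l // act_linl.
Qed.

Lemma actZl a x (w : Delta) : act (a *: x) w = a%:C%C *: act x w.
Proof. by have := act_linl a x 0 w; rewrite act0l !addr0. Qed.

Lemma actDl x y (w : Delta) : act (x + y) w = act x w + act y w.
Proof. by have := act_linl 1 x y w; rewrite rmorph1 !scale1r. Qed.

Lemma actNl x (w : Delta) : act (- x) w = - act x w.
Proof. by have := actZl (-1) x w; rewrite rmorphN1 !scaleN1r. Qed.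

Lemma act_suml0 (I : Type) (s : seq I) (P : pred I) F (w : Delta) :
  act (\sum_(i <- s | P i) F i) w = \sum_(i <- s | P i) act (F i) w.
Proof.
by elim/big_rec2: _ => [|i x y _ <-]; rewrite ?act0l // actDl.
Qed.

Lemma act_bivector k (E : 'I_k -> clifford R N) (B : 'M[R]_k) (w : Delta) :
  act (bivector E B) w =
  2^-1 *: \sum_(i < k) \sum_(j < k | (i < j)%N) (B i j)%:C%C *: act (E i * E j) w.
Proof.
rewrite /bivector actZl fmorphV rmorph_nat act_suml0; congr (_ *: _).
by apply: eq_bigr => i _; rewrite act_suml.
Qed.

Variables (U : set M).
Hypothesis oU : open U.

Lemma sp_smooth_bivector (A : M -> 'M[R]_N) w :
  (forall i j, smooth_fun U (fun q => A q i j)) -> sp_smooth U w ->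
  sp_smooth U (fun q => act (bivector (@clgen R N) (A q)) (w q)).
Proof.
move=> sA sw.
have s2 : sp_smooth U (fun q => (2^-1 : R)%:C%C *: \sum_(i < N) \sum_(j < N | (i < j)%N)
    (A q i j)%:C%C *: act (clgen R i * clgen R j) (w q)).
  apply: (sp_smoothZ oU (@smooth_fun_cst _ _ M U _)).
  apply: (sp_smooth_sum _ oU) => i _; apply: (sp_smooth_sum _ oU) => j _.
  apply: (sp_smoothZ oU (sA i j)); apply: (sp_smooth_linear oU (act_linr _) sw).
move=> t; apply: csmooth_eq oU _ (s2 t) => q _.
by rewrite act_bivector fmorphV rmorph_nat.
Qed.

Lemma spinor_derive_bivector p v (A : M -> 'M[R]_N) w : U p -> tangent p v ->
  (forall i j, smooth_fun U (fun q => A q i j)) -> sp_smooth U w ->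
  spinor_derive v (fun q => act (bivector (@clgen R N) (A q)) (w q)) =
  act (bivector (@clgen R N) (\matrix_(i, j) v (fun q => A q i j))) (w p)
  + act (bivector (@clgen R N) (A p)) (spinor_derive v w).
Proof.
move=> Up tv sA sw.
have sT i j : sp_smooth U (fun q => act (clgen R i * clgen R j) (w q)).
  exact: (sp_smooth_linear oU (act_linr _) sw).
have s1 i j : sp_smooth U (fun q => (A q i j)%:C%C *: act (clgen R i * clgen R j) (w q)).
  exact: (sp_smoothZ oU (sA i j) (sT i j)).
have s2 (i : 'I_N) : sp_smooth U (fun q => \sum_(j < N | (i < j)%N)
    (A q i j)%:C%C *: act (clgen R i * clgen R j) (w q)).
  by apply: (sp_smooth_sum _ oU) => j _; apply: s1.
have -> : (fun q => act (bivector (@clgen R N) (A q)) (w q)) =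
    (fun q => (2^-1 : R)%:C%C *: \sum_(i < N) \sum_(j < N | (i < j)%N)
    (A q i j)%:C%C *: act (clgen R i * clgen R j) (w q)).
  by apply/funext => q; rewrite act_bivector fmorphV rmorph_nat.
rewrite (spinor_deriveZ oU Up tv (@smooth_fun_cst _ _ M U _)); last first.
  by apply: (sp_smooth_sum _ oU) => i _; apply: s2.
rewrite (tangent_cst tv) scale0r add0r !act_bivector fmorphV rmorph_nat.
apply: etrans (scalerDr _ _ _); congr (_ *: _); rewrite (spinor_derive_sum oU Up tv) => [|i _]; last exact: s2.
rewrite -big_split; apply: eq_bigr => i _ /=.
rewrite (spinor_derive_sum oU Up tv) => [|j _]; last exact: s1.
rewrite -big_split; apply: eq_bigr => j _ /=.
rewrite (spinor_deriveZ oU Up tv (sA i j) (sT i j)) mxE; congr (_ + _ *: _).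
exact: (spinor_derive_linear oU Up tv (act_linr _) sw).
Qed.

End Representation.
End SpinorDerivative.

(** * Curvature of a covariant derivative given by two skew matrices of connection forms *)

Lemma bivector_lin (R : numFieldType) (A : algType R) n (E : 'I_n -> A) (a : R)
    (B C : 'M[R]_n) :
  bivector E (a *: B + C) = a *: bivector E B + bivector E C.
Proof.
rewrite /bivector scalerA mulrC -scalerA -scalerDr; congr (_ *: _).
rewrite scaler_sumr -big_split; apply: eq_bigr => i _ /=.
rewrite scaler_sumr -big_split; apply: eq_bigr => j _ /=.
by rewrite !mxE scalerDl scalerA.
Qed.

Lemma bivectorD (R : numFieldType) (A : algType R) n (E : 'I_n -> A)
    (B C : 'M[R]_n) : bivector E (B + C) = bivector E B + bivector E C.
Proof. by rewrite -[B]scale1r bivector_lin !scale1r. Qed.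

Lemma bivectorB (R : numFieldType) (A : algType R) n (E : 'I_n -> A)
    (B C : 'M[R]_n) : bivector E (B - C) = bivector E B - bivector E C.
Proof. by rewrite addrC -scaleN1r bivector_lin scaleN1r addrC. Qed.

Definition smooth_mx (R : realType) (n : nat) (M : manifold R n) (U : set M) k
  (w : M -> 'M[R]_k) := forall i j, smooth_fun U (fun q => w q i j).

Definition derive_mx (R : realType) (n : nat) (M : manifold R n) (v : tvector M) k
  (w : M -> 'M[R]_k) := \matrix_(i, j) v (fun q => w q i j).

Section SpinorCurvature.
Context (R : realType) (n r m : nat) (M : manifold R n).
Variables (kn : spinor_rep R n) (kr : spinor_rep R r).
Local Notation Delta := (spinor R n r m).
Local Notation bivn := (bivector (@clgen R n)).
Local Notation bivr := (bivector (@clgen R r)).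

(** The covariant derivative in a local trivialization, with [w] and [th] the values on [v] of the
    two connection forms. *)
Definition nabla (v : tvector M) (w : 'M[R]_n) (th : 'M[R]_r) (psi : M -> Delta)
    (p : M) : Delta :=
  spinor_derive v psi + clact kn (bivn w) (psi p) + kappam kr (bivr th) (psi p).

(** Difference of the two expansions given by [nabla2]: the first-order terms [c], [e], [f], [k]
    occur in both, and the mixed products [h], [l] cancel because the two actions commute. The
    letters [b], [g] give the curvature on one tensor factor, [d], [t] that on the other. *)
Let collect (a a' b1 b2 b3 c d1 d2 d3 e f g g' h h' k l l' t t' : Delta) :
  h' = l -> l' = h ->
  a + (b1 + c) + (d1 + e) + (f + g + h) + (k + l + t)
  - (a' + (b2 + f) + (d2 + k) + (c + g' + h') + (e + l' + t'))
  - (a - a' + b3 + d3) =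
  b1 - b2 - b3 + (g - g') + (d1 - d2 - d3 + (t - t')).
Proof. by move=> -> ->; apply/ffunP => x; rewrite !ffunE; ring. Qed.

Let clact_split (a b c x y : clifford R n) (w : Delta) :
  clact kn (a - b - c + (x * y - y * x)) w =
  clact kn a w - clact kn b w - clact kn c w
  + (clact kn x (clact kn y w) - clact kn y (clact kn x w)).
Proof.
have cl := @clact_linl R n r m kn.
by rewrite !(actDl cl) !(actNl cl) !clactM.
Qed.

Let kappam_split (a b c x y : clifford R r) (w : Delta) :
  kappam kr (a - b - c + (x * y - y * x)) w =
  kappam kr a w - kappam kr b w - kappam kr c w
  + (kappam kr x (kappam kr y w) - kappam kr y (kappam kr x w)).
Proof.
have kl := @kappam_linl R n r m kr.
by rewrite kappam_comm !(actDl kl) !(actNl kl).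
Qed.

Let subE (u w : Delta) t : (u - w) t = u t - w t.
Proof. by rewrite !ffunE. Qed.

Variables (U : set M) (X Y : vfield M) (p : M).
Hypotheses (oU : open U) (vX : vector_field U X) (vY : vector_field U Y) (Up : U p).

Lemma nabla_smooth (Z : vfield M) w th psi : vector_field U Z ->
  smooth_mx U w -> smooth_mx U th -> sp_smooth U psi ->
  sp_smooth U (fun q => nabla (Z q) (w q) (th q) psi q).
Proof.
move=> vZ sw sth spsi.
have s1 := sp_smooth_derive oU vZ spsi.
have s2 := sp_smooth_bivector (@clact_linl R n r m kn)
  (fun x c u w => clact_linr kn c x u w) oU sw spsi.
have s3 := sp_smooth_bivector (@kappam_linl R n r m kr)
  (fun x c u w => kappam_linr kr c x u w) oU sth spsi.
exact: (sp_smoothD oU (sp_smoothD oU s1 s2) s3).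
Qed.

Lemma nabla2 (Z T : vfield M) wZ wT thZ thT psi :
  vector_field U Z -> vector_field U T -> smooth_mx U wT -> smooth_mx U thT ->
  sp_smooth U psi ->
  nabla (Z p) wZ thZ (fun q => nabla (T q) (wT q) (thT q) psi q) p =
  spinor_derive (Z p) (fun q => spinor_derive (T q) psi)
  + (clact kn (bivn (derive_mx (Z p) wT)) (psi p)
     + clact kn (bivn (wT p)) (spinor_derive (Z p) psi))
  + (kappam kr (bivr (derive_mx (Z p) thT)) (psi p)
     + kappam kr (bivr (thT p)) (spinor_derive (Z p) psi))
  + (clact kn (bivn wZ) (spinor_derive (T p) psi)
     + clact kn (bivn wZ) (clact kn (bivn (wT p)) (psi p))
     + clact kn (bivn wZ) (kappam kr (bivr (thT p)) (psi p)))
  + (kappam kr (bivr thZ) (spinor_derive (T p) psi)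
     + kappam kr (bivr thZ) (clact kn (bivn (wT p)) (psi p))
     + kappam kr (bivr thZ) (kappam kr (bivr (thT p)) (psi p))).
Proof.
move=> vZ vT sw sth spsi; have tZ := vZ.1 p Up.
have s1 := sp_smooth_derive oU vT spsi.
have s2 := sp_smooth_bivector (@clact_linl R n r m kn)
  (fun x c u w => clact_linr kn c x u w) oU sw spsi.
have s3 := sp_smooth_bivector (@kappam_linl R n r m kr)
  (fun x c u w => kappam_linr kr c x u w) oU sth spsi.
rewrite /nabla; congr (_ + _ + _); cbv beta.
- rewrite (spinor_deriveD oU Up tZ (sp_smoothD oU s1 s2) s3).
  rewrite (spinor_deriveD oU Up tZ s1 s2); congr (_ + _ + _).
    exact: (spinor_derive_bivector (@clact_linl R n r m kn)
      (fun x c u w => clact_linr kn c x u w) oU Up tZ sw spsi).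
  exact: (spinor_derive_bivector (@kappam_linl R n r m kr)
      (fun x c u w => kappam_linr kr c x u w) oU Up tZ sth spsi).
- exact: etrans (clactDr _ _ _ _) (congr1 (+%R^~ _) (clactDr _ _ _ _)).
- exact: etrans (kappamDr _ _ _ _) (congr1 (+%R^~ _) (kappamDr _ _ _ _)).
Qed.

(** The two parts do not interact, as they act on different tensor factors. [wB] and [thB] stand for
    the connection forms on the bracket and enter linearly, at the single point [p]. *)
Lemma nabla_curvature wX wY thX thY wB thB psi :
  smooth_mx U wX -> smooth_mx U wY -> smooth_mx U thX -> smooth_mx U thY ->
  skew (wX p) -> skew (wY p) -> skew (thX p) -> skew (thY p) ->
  sp_smooth U psi ->
  nabla (X p) (wX p) (thX p) (fun q => nabla (Y q) (wY q) (thY q) psi q) p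
  - nabla (Y p) (wY p) (thY p) (fun q => nabla (X q) (wX q) (thX q) psi q) p
  - nabla (bracket X Y p) wB thB psi p =
  clact kn (bivn (derive_mx (X p) wY - derive_mx (Y p) wX - wB
                  + (wY p *m wX p - wX p *m wY p))) (psi p)
  + kappam kr (bivr (derive_mx (X p) thY - derive_mx (Y p) thX - thB
                     + (thY p *m thX p - thX p *m thY p))) (psi p).
Proof.
move=> sX sY tX tY kX kY lX lY spsi; rewrite !nabla2 //.
have -> : nabla (bracket X Y p) wB thB psi p =
   spinor_derive (X p) (fun q => spinor_derive (Y q) psi)
   - spinor_derive (Y p) (fun q => spinor_derive (X q) psi)
   + clact kn (bivn wB) (psi p) + kappam kr (bivr thB) (psi p).
  congr (_ + _ + _); apply/ffunP => t.
  rewrite subE !spinor_deriveE (cderive_bracket _ _ oU Up (spsi t)).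
  have E (Z : vfield M) : (fun q => cderive (Z q) (fun q' => psi q' t)) =
      (fun q => spinor_derive (Z q) psi t).
    by apply/funext => q; rewrite spinor_deriveE.
  by rewrite !E.
apply: etrans (collect _ _ _ _ _ _ _ _ _ _ _ _ _ _ _ _
  (clact_kappam _ _ _ _ _) (esym (clact_kappam _ _ _ _ _))) _.
rewrite [bivn (_ + _)]bivectorD [bivr (_ + _)]bivectorD.
rewrite -(bivector_commutator (@clgen_family R n) kX kY).
rewrite -(bivector_commutator (@clgen_family R r) lX lY) !bivectorB.
by rewrite clact_split kappam_split.
Qed.

End SpinorCurvature.

(** * Local sections of principal bundles and the frames they define *)

Section BundleSections.
Context (R : realType) (n : nat) (M : manifold R n).
Implicit Types (U : set M) (p : M).

Lemma local_section_sub (A : pzRingType) (J : Type) (co : J -> A -> R)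
    (G K : set A) (P : principal_bundle M co G K) (U V : set M) s :
  V `<=` U -> local_section (P := P) U s -> local_section (P := P) V s.
Proof. by move=> VU [s1 s2]; split=> [p /VU/s1|i p /VU]; last exact: s2. Qed.

Lemma local_section_sec (A : pzRingType) (J : Type) (co : J -> A -> R)
    (G K : set A) (P : principal_bundle M co G K) i :
  local_section (P := P) (pb_patch P i) (pb_sec P i).
Proof. by split=> [p|j p ip jp]; [apply: pb_sec_proj|apply: pb_sec_smooth]. Qed.

(** Translation by a constant changes the transition function [k] into [k * x], which is smooth as
    right multiplication is linear in the coordinates of interest. *)
Lemma local_section_act (A : pzRingType) (J : Type) (co : J -> A -> R)
    (G K : set A) (P : principal_bundle M co G K) U s (x : A) :
  (forall W (k : M -> A), open W -> smooth_map co W k ->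
     smooth_map co W (fun q => k q * x)) ->
  (forall y, G y -> G (y * x)) -> G x ->
  local_section (P := P) U s -> local_section (P := P) U (fun q => pb_act P (s q) x).
Proof.
move=> smx Gx Gx1 [s1 s2]; split=> [p Up|i p Up ip]; first by rewrite pb_act_proj // s1.
have [W [k [oW Wp sk kE]]] := s2 i p Up ip.
exists W, (fun q => k q * x); split; [exact: oW|exact: Wp|exact: smx|].
by move=> q /kE[Gk ->]; split; [apply: Gx|rewrite -pb_actM].
Qed.

Lemma smooth_map_mx_mulr a b c (W : set M) (k : M -> 'M[R]_(a, b)) (x : 'M[R]_(b, c)) :
  open W -> smooth_map (@mx_coord R a b) W k ->
  smooth_map (@mx_coord R a c) W (fun q => k q *m x).
Proof.
move=> oW sk [i j].
have := @smooth_fun_sum _ _ M W _ (index_enum _) xpredT (fun l q => x l j * k q i l) oW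
  (fun l _ => smooth_funZ (x l j) oW (sk (i, l))).
by apply: smooth_fun_eq => // q _; rewrite /mx_coord /= mxE; apply: eq_bigr => l _; rewrite mulrC.
Qed.

Lemma smooth_map_spin2_mulr r (W : set M) (k : M -> clifford R n * clifford R r) x :
  open W -> smooth_map (@spin2_coord R n r) W k ->
  smooth_map (@spin2_coord R n r) W (fun q => k q * x).
Proof.
move=> oW sk [A|A].
  have := @smooth_fun_sum _ _ M W _ (index_enum _) xpredT
    (fun B q => (clsign R B (symdiff B A) * x.1 (symdiff B A)) * (k q).1 B) oW
    (fun B _ => smooth_funZ _ oW (sk (inl B))).
  apply: smooth_fun_eq => // q _; rewrite /spin2_coord /= ffunE.
  by apply: eq_bigr => B _; rewrite -mulrA [x.1 _ * _]mulrC.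
have := @smooth_fun_sum _ _ M W _ (index_enum _) xpredT
  (fun B q => (clsign R B (symdiff B A) * x.2 (symdiff B A)) * (k q).2 B) oW
  (fun B _ => smooth_funZ _ oW (sk (inr B))).
apply: smooth_fun_eq => // q _; rewrite /spin2_coord /= ffunE.
by apply: eq_bigr => B _; rewrite -mulrA [x.2 _ * _]mulrC.
Qed.

Lemma SO_mul r (x y : 'M[R]_r) : SO x -> SO y -> SO (x *m y).
Proof.
move=> [ox dx] [oy dy]; split; last by rewrite det_mulmx dx dy mulr1.
by rewrite trmx_mul mulmxA -[y^T *m _ *m _]mulmxA ox mulmx1.
Qed.

Section AuxBundle.
Variables (r : nat) (PF : so_bundle M r) (U : set M) (sg : M -> pb_total PF).
Hypotheses (oU : open U) (lsg : local_section (P := PF) U sg).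

Lemma F_section_sub V (f : pb_total PF -> 'cV[R]_r) : V `<=` U ->
  F_section U f -> F_section V f.
Proof.
move=> VU [f1 f2]; split=> [q x /VU|i j]; first exact: f1.
by apply: smooth_fun_sub (f2 i j) => p [/VU].
Qed.

(** [h k] represents, as an equivariant function, the [k]-th vector of the frame
    [sg] of [F]. *)
Lemma F_section_frame : exists h : 'I_r -> pb_total PF -> 'cV[R]_r,
  (forall k, F_section U (h k)) /\
  (forall k p, U p -> h k (sg p) = delta_mx k 0).
Proof.
have [s1 s2] := lsg.
have E b : U (pb_proj PF b) ->
    exists A : 'M[R]_r, SO A /\ sg (pb_proj PF b) = pb_act PF b A.
  by move=> Ub; have [A oA e] := pb_act_trans (esym (s1 _ Ub)); exists A.
(* [tr b] is the element carrying [b] to the value of [sg] over the same point, unique because the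
   stabilizers in [PF] are trivial. Equivariance follows from [tr b = x *m tr (b x)], and along a
   patch section [tr] is a smooth transition function. *)
pose tr b : 'M[R]_r := if pselect (U (pb_proj PF b)) is left Ub
  then projT1 (cid (E b Ub)) else 0.
have trP b : U (pb_proj PF b) ->
    SO (tr b) /\ sg (pb_proj PF b) = pb_act PF b (tr b).
  by move=> Ub; rewrite /tr; case: pselect => // Ub'; case: cid.
have trU b A : U (pb_proj PF b) -> SO A -> sg (pb_proj PF b) = pb_act PF b A ->
    tr b = A.
  move=> Ub oA eA; have [oT eT] := trP b Ub.
  have oAt : SO A^T.
    have [oo dA] := oA; split; last by rewrite det_tr.
    by rewrite trmxK; apply: mulmx1C.
  have : pb_act PF b (tr b *m A^T) = b.
    rewrite (pb_actM b oT oAt) -eT eA -(pb_actM b oA oAt).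
    by rewrite [A * _](mulmx1C oA.1) pb_act1.
  move=> /(pb_act_stab b (SO_mul oT oAt)) /= e.
  by rewrite -[tr b]mulmx1 -oA.1 mulmxA e mul1mx.
exists (fun k b => tr b *m delta_mx k 0); split=> [k|k p Up]; last first.
  rewrite (@trU _ 1%:M) ?mul1mx ?s1 //; last by rewrite pb_act1.
  by split; rewrite ?trmx1 ?mulmx1 ?det1.
split=> [b x Ub ox|i j].
  have Ubx : U (pb_proj PF (pb_act PF b x)) by rewrite pb_act_proj.
  have [ot e] := trP _ Ubx.
  rewrite mulmxA (@trU b (x *m tr (pb_act PF b x))) //; first exact: SO_mul.
  by rewrite (pb_actM b ox ot) -e pb_act_proj.
apply: smooth_fun_local => p [Up ip].
have [W [c [oW Wp sc cE]]] := s2 i p Up ip.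
exists (W `&` (U `&` pb_patch PF i)) => //.
have oV : open (W `&` (U `&` pb_patch PF i)).
  by do 2!apply: openI => //; apply: pb_patch_open.
apply: smooth_fun_eq oV _ (smooth_map_mx_mulr (delta_mx k (0 : 'I_1)) oV _ j).
  move=> q [Wq [Uq iq]]; have [oc e] := cE q Wq.
  by rewrite /= (@trU _ (c q)) // pb_sec_proj.
by move=> l; apply: smooth_fun_sub (sc l) => q [].
Qed.

Lemma F_dot_inv f1 f2 : F_section U f1 -> F_section U f2 ->
  forall b, U (pb_proj PF b) ->
  ip (@F_dot R n r M PF) sg f1 f2 (pb_proj PF b) = F_dot b (f1 b) (f2 b).
Proof.
move=> [e1 _] [e2 _] b Ub.
have [A oA e] := pb_act_trans (esym (lsg.1 _ Ub)).
rewrite /ip e -(e1 b A Ub oA) -(e2 b A Ub oA).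
set v := f1 _; set w := f2 _.
have T x y : F_dot b x y = (x^T *m y) 0 0.
  by rewrite mxE; apply: eq_bigr => k _; rewrite mxE.
by rewrite !T trmx_mul -mulmxA [A^T *m _]mulmxA oA.1 mul1mx -T.
Qed.

(** By invariance the inner product may be computed along the patch sections, where [F_section]
    provides smooth coordinates. *)
Lemma F_dot_smooth f1 f2 : F_section U f1 -> F_section U f2 ->
  smooth_fun U (ip (@F_dot R n r M PF) sg f1 f2).
Proof.
move=> F1 F2; apply: smooth_fun_local => p Up.
have [i ip] := pb_patch_cover PF p.
exists (U `&` pb_patch PF i) => //.
have oV : open (U `&` pb_patch PF i) by apply: openI => //; apply: pb_patch_open.
have := @smooth_fun_sum _ _ M _ _ (index_enum _) xpredT
  (fun k q => f1 (pb_sec PF i q) k 0 * f2 (pb_sec PF i q) k 0) oV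
  (fun k _ => smooth_funM oV (F1.2 i (k, 0)) (F2.2 i (k, 0))).
apply: smooth_fun_eq => // q [Uq iq].
have pq := pb_sec_proj iq.
by rewrite -{3}pq F_dot_inv // pq.
Qed.

End AuxBundle.
End BundleSections.

Section TangentFrames.
Context (R : realType) (n : nat) (M : manifold R n) (g : metric M).
Variables (V : set M) (oV : open V).
Implicit Types (s t u w : vfield M) (p : M).

Lemma metric_suml p (I : finType) (a : I -> R) (u : I -> tvector M) (w : tvector M) :
  (forall i, tangent p (u i)) -> tangent p w ->
  g p (\sum_i a i *: u i) w = \sum_i a i * g p (u i) w.
Proof.
move=> tu tw.
have g0 : g p 0 w = 0.
  have := ip_linear g (-1) (@tangent0 _ _ M p) (@tangent0 _ _ M p) tw.
  by rewrite scaler0 addr0 mulN1r addNr.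
suff [] : tangent p (\sum_i a i *: u i) /\
   g p (\sum_i a i *: u i) w = \sum_i a i * g p (u i) w by [].
elim/big_rec2: _ => [|i x y _ [ty <-]]; first by split=> //; apply: tangent0.
by split; [apply: tangent_scaleD|rewrite ip_linear].
Qed.

Lemma metricC s t : vector_field V s -> vector_field V t ->
  forall p, V p -> ip (fun p => g p) id s t p = ip (fun p => g p) id t s p.
Proof. by move=> [ts _] [tt _] p Vp; apply: ip_sym; [apply: ts|apply: tt]. Qed.

Lemma metricB s t u w : vector_field V s -> vector_field V t ->
  vector_field V u -> vector_field V w -> forall p, V p ->
  ip (fun p => g p) id (fun b => s b - t b - u b) w p =
  ip (fun p => g p) id s w p - ip (fun p => g p) id t w p - ip (fun p => g p) id u w p.
Proof.
move=> [ts _] [tt _] [tu _] [tw _] p Vp; rewrite /ip /=.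
have {}ts := ts p Vp; have {}tt := tt p Vp; have {}tu := tu p Vp; have {}tw := tw p Vp.
have -> : s p - t p - u p = -1 *: u p + (-1 *: t p + s p).
  by rewrite !scaleN1r addrC [- t p + _]addrC.
rewrite !ip_linear //; last exact: tangent_scaleD.
by ring.
Qed.

Lemma orthonormal_parseval (u : 'I_n -> vfield M) s t p :
  (forall q, V q -> orthonormal_basis g q (fun i => u i q)) ->
  vector_field V s -> vector_field V t -> V p ->
  ip (fun p => g p) id s t p =
  \sum_l ip (fun p => g p) id s (u l) p * ip (fun p => g p) id t (u l) p.
Proof.
move=> ou [ts _] [tt _] Vp; rewrite /ip /=.
have {}ts := ts p Vp; have {}tt := tt p Vp.
have [tu uu span] := ou p Vp; have [a ->] := span _ ts.
rewrite metric_suml //; apply: eq_bigr => l _.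
rewrite (ip_sym g (tu l) tt) metric_suml //; congr (_ * _).
rewrite (bigD1 l) //= big1 => [|i ni]; first by rewrite uu eqxx mulr1 addr0.
by rewrite uu (negPf ni) mulr0.
Qed.

End TangentFrames.

(** * Local sections of the spin structure through a given point *)

Section LocalSections.
Context (R : realType) (n r m : nat) (M : manifold R n) (g : metric M).
Variables (PF : so_bundle M r) (kn : spinor_rep R n) (kr : spinor_rep R r).
Variables (K : set (clifford R n * clifford R r)) (Q : spin_structure g PF K).

(** Equivariance rewrites the translated values as the fixed linear operator of the inverse of [x],
    applied to the values along the patch section. *)
Lemma smooth_section_act (U : set M) i0 (x : clifford R n * clifford R r)
    (phi : pb_total Q -> spinor R n r m) : open U -> spin2 x ->
  S_section kn kr U phi ->
  sp_smooth (U `&` pb_patch Q i0) (fun y => phi (pb_act Q (pb_sec Q i0 y) x)).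
Proof.
move=> oU sx [eq_phi sm_phi].
have [y1 sy1 e1] := spin_inv sx.1; have [y2 sy2 e2] := spin_inv sx.2.
have sy : spin2 (y1, y2) by [].
have oV : open (U `&` pb_patch Q i0) by apply: openI => //; apply: pb_patch_open.
have sm0 : sp_smooth (U `&` pb_patch Q i0) (fun y => phi (pb_sec Q i0 y)).
  by move=> t; split; [exact: (sm_phi i0 (t, true))|exact: (sm_phi i0 (t, false))].
have lin := fun c (u w : spinor R n r m) => act_tensor_linr c
  (kn (clcomplex y1)) (kr (clcomplex y2)) u w.
have sm1 := sp_smooth_linear oV lin sm0.
move=> t; apply: csmooth_eq oV _ (sm1 t) => y [Uy iy].
rewrite -[phi (pb_act _ _ _)](eq_phi _ (y1, y2)) //; last first.
  by rewrite pb_act_proj // pb_sec_proj.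
rewrite -pb_actM //.
have -> : x * (y1, y2) = 1 by rewrite /GRing.mul /= /mul_pair /= e1 e2.
by rewrite pb_act1.
Qed.

(** The element [x] is found over the one point [p] and kept constant, so the frames of the new
    section are constant orthogonal combinations of those of the patch section. *)
Lemma section_through (U : set M) (q : pb_total Q) : open U -> U (pb_proj Q q) ->
  exists (V : set M) (s : M -> pb_total Q),
  [/\ open V, V (pb_proj Q q), V `<=` U & s (pb_proj Q q) = q] /\
  [/\ local_section V s,
      forall i, vector_field V (fun y => frm (s y) i),
      local_section (P := PF) V (fun y => auxmap (s y)) &
      forall phi : pb_total Q -> spinor R n r m, S_section kn kr U phi ->
        sp_smooth V (fun y => phi (s y))].
Proof.
move=> oU Uq; set p := pb_proj Q q in Uq *.
have [i0 ip0] := pb_patch_cover Q p.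
have [x sx qE] := pb_act_trans (pb_sec_proj ip0 : pb_proj Q _ = pb_proj Q q).
have [A1 oA1 lA1] := spin_lambda sx.1; have [A2 oA2 lA2] := spin_lambda sx.2.
have VU : U `&` pb_patch Q i0 `<=` pb_patch Q i0 by move=> y [].
have oV : open (U `&` pb_patch Q i0) by apply: openI => //; apply: pb_patch_open.
exists (U `&` pb_patch Q i0), (fun y => pb_act Q (pb_sec Q i0 y) x).
split; first by split=> // y [].
split.
- apply: local_section_act; [| |exact: sx|].
  + by move=> W k oW; apply: smooth_map_spin2_mulr.
  + by move=> y [y1 y2]; split; apply: spinM; [|exact: sx.1| |exact: sx.2].
  + exact: (local_section_sub VU (local_section_sec _)).
- move=> i; rewrite (_ : (fun y => _) = fun y => \sum_j A1 j i *: frm (pb_sec Q i0 y) j).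
    apply: (vector_field_sum (fun j => A1 j i) oV) => j.
    exact: (vector_field_sub VU (frm_smooth i0 j)).
  by apply/funext => y; rewrite (frm_act _ sx lA1).
- rewrite (_ : (fun y => _) = fun y => pb_act PF (auxmap (pb_sec Q i0 y)) A2).
    apply: local_section_act; [| |exact: oA2|].
    + by move=> W k oW; apply: smooth_map_mx_mulr.
    + by move=> y oy; apply: SO_mul.
    + exact: (local_section_sub VU (aux_smooth i0)).
  by apply/funext => y; rewrite (aux_act _ sx lA2).
- by move=> phi; apply: smooth_section_act.
Qed.

End LocalSections.

(** Needed to iterate the local formula, which identifies a derivative of a section only over
    [V]. *)
Lemma nabla_local (R : realType) (n r m : nat) (M : manifold R n)
    (kn : spinor_rep R n) (kr : spinor_rep R r) (V : set M) p v w th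
    (u1 u2 : M -> spinor R n r m) : open V -> V p -> tangent p v ->
  sp_smooth V u1 -> (forall q, V q -> u2 q = u1 q) ->
  nabla kn kr v w th u2 p = nabla kn kr v w th u1 p.
Proof.
move=> oV Vp tv s1 e; rewrite /nabla e //; congr (_ + _ + _).
by apply: esym; apply: (spinor_derive_local oV Vp tv s1) => q /e.
Qed.

Lemma mx3E (R : pzRingType) k (a b c d : 'M[R]_k) i j :
  (a - b - c + d) i j = a i j - b i j - c i j + d i j.
Proof. by rewrite !mxE. Qed.

Lemma derive_mxE (R : realType) (n : nat) (M : manifold R n) (v : tvector M) k
  (w : M -> 'M[R]_k) i j : derive_mx v w i j = v (fun q => w q i j).
Proof. by rewrite mxE. Qed.

(** * Curvature of the induced connection and its Clifford contraction *)

Section Curvature.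
Context (R : realType) (n r m : nat) (M : manifold R n) (g : metric M).
Variables (D : vfield M -> vfield M -> vfield M) (LC : levi_civita g D).
Variables (PF : so_bundle M r).
Variables (DF : vfield M -> (pb_total PF -> 'cV[R]_r) -> pb_total PF -> 'cV[R]_r).
Hypothesis metricDF : F_connection DF.
Variables (kn : spinor_rep R n) (kr : spinor_rep R r).
Variables (K : set (clifford R n * clifford R r)) (Q : spin_structure g PF K).
Variable DS : vfield M -> (pb_total Q -> spinor R n r m) -> pb_total Q -> spinor R n r m.
Hypothesis inducedDS : induced_connection D DF kn kr DS.

Variables (V : set M) (s : M -> pb_total Q).
Hypotheses (oV : open V) (ls : local_section V s).
Let u i : vfield M := fun y => frm (s y) i.
Let sg y := auxmap (s y).
Hypotheses (vu : forall i, vector_field V (u i))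
  (lsg : local_section (P := PF) V sg).
Variable h : 'I_r -> pb_total PF -> 'cV[R]_r.
Hypotheses (Gh : forall k, F_section V (h k))
  (hE : forall k p, V p -> h k (sg p) = delta_mx k 0).
Variable phi : pb_total Q -> spinor R n r m.
Hypotheses (Gphi : S_section kn kr V phi)
  (spsi : sp_smooth V (fun y => phi (s y))).

Local Notation gip := (fun p => g p).
Local Notation fip := (@F_dot R n r M PF).

(** The assumptions on metric connections are verified twice: for [TM], with the identity as
    projection and the frame [u], and for [F], along [sg] and with the frame [h]. *)
Let connD : is_connection id (@vector_field R n M) D. Proof. by case: LC. Qed.
Let metricD : metric_connection id (@vector_field R n M) gip D. Proof. by case: LC. Qed.
Let gK p : V p -> id p = p. Proof. by []. Qed.
Let ginv (a b : vfield M) : vector_field V a -> vector_field V b ->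
  forall p, V (id p) -> ip gip id a b (id p) = g p (a p) (b p).
Proof. by []. Qed.
Let gsmooth (a b : vfield M) : vector_field V a -> vector_field V b ->
  smooth_fun V (ip gip id a b).
Proof. exact: ip_smooth. Qed.
Let uorth q : V q -> orthonormal_basis g q (fun i => u i q).
Proof. by move=> Vq; have := frm_orthonormal (s q); rewrite ls.1. Qed.
Let uframe i j p : V p -> ip gip id (u i) (u j) p = (i == j)%:R.
Proof. by move=> /uorth[_ uu _]; apply: uu. Qed.
Let gpars (a b : vfield M) p : vector_field V a -> vector_field V b -> V p ->
  ip gip id a b p = \sum_l ip gip id a (u l) p * ip gip id b (u l) p.
Proof. exact: orthonormal_parseval uorth. Qed.

Let connF : is_connection (pb_proj PF) (@F_section R n r M PF) DF. Proof. by case: metricDF. Qed.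
Let metricF : metric_connection (pb_proj PF) (@F_section R n r M PF) fip DF.
Proof. by case: metricDF. Qed.
Let sgK p : V p -> pb_proj PF (sg p) = p. Proof. exact: lsg.1. Qed.
Let finv := F_dot_inv lsg.
Let fsmooth := F_dot_smooth oV lsg.
Let fC (a b : pb_total PF -> 'cV[R]_r) : F_section V a -> F_section V b ->
  forall p, V p -> ip fip sg a b p = ip fip sg b a p.
Proof. by move=> _ _ p _; apply: eq_bigr => k _; rewrite mulrC. Qed.
Let fB (a b c w : pb_total PF -> 'cV[R]_r) : F_section V a -> F_section V b ->
  F_section V c -> F_section V w -> forall p, V p ->
  ip fip sg (fun x => a x - b x - c x) w p =
  ip fip sg a w p - ip fip sg b w p - ip fip sg c w p.
Proof.
move=> _ _ _ _ p _; rewrite /ip /F_dot -!sumrB; apply: eq_bigr => k _.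
by rewrite !mxE !mulrBl.
Qed.
Let fh (a : pb_total PF -> 'cV[R]_r) l p : V p -> ip fip sg a (h l) p = a (sg p) l 0.
Proof.
move=> Vp; rewrite /ip /F_dot hE // (bigD1 l) //= big1 => [|k nk].
  by rewrite mxE !eqxx mulr1 addr0.
by rewrite mxE (negPf nk) mulr0.
Qed.
Let fframe i j p : V p -> ip fip sg (h i) (h j) p = (i == j)%:R.
Proof. by move=> Vp; rewrite fh // hE // mxE andbT eq_sym. Qed.
Let fpars (a b : pb_total PF -> 'cV[R]_r) p : F_section V a -> F_section V b -> V p ->
  ip fip sg a b p = \sum_l ip fip sg a (h l) p * ip fip sg b (h l) p.
Proof. by move=> _ _ Vp; apply: eq_bigr => l _; rewrite !fh. Qed.

Let omega X := conn_form gip D id u X.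
Let theta X := conn_form fip DF sg h X.

Let DS_nabla X f p : vector_field V X -> S_section kn kr V f -> V p ->
  DS X f (s p) = nabla kn kr (X p) (omega X p) (theta X p) (fun y => f (s y)) p.
Proof.
move=> vX Gf Vp; have [_ DSE] := inducedDS oV vX Gf.
rewrite (DSE s h ls Gh hE p Vp) /nabla.
rewrite (act_bivector (@clact_linl R n r m kn)) (act_bivector (@kappam_linl R n r m kr)).
apply: (f_equal2 +%R (f_equal2 +%R (erefl _) (f_equal2 *:%R (erefl _) _))
  (f_equal2 *:%R (erefl _) _)).
  by apply: eq_bigr => i _; apply: eq_bigr => j _; rewrite mxE.
by apply: eq_bigr => i _; apply: eq_bigr => j _; rewrite mxE.
Qed.

Lemma DS_curvature X Y p : vector_field V X -> vector_field V Y -> V p ->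
  curvature DS X Y phi (s p) =
  clact kn (bivector (@clgen R n) (curv_form gip D id u X Y p)) (phi (s p))
  + kappam kr (bivector (@clgen R r) (curv_form fip DF sg h X Y p)) (phi (s p)).
Proof.
move=> vX vY Vp; have vB := bracket_vector_field oV vX vY.
have GD Z : vector_field V Z -> S_section kn kr V (DS Z phi).
  by move=> vZ; case: (inducedDS oV vZ Gphi).
have so Z i j : vector_field V Z -> smooth_fun V (fun q => omega Z q i j).
  by move=> vZ; apply: (conn_form_smooth oV connD gsmooth).
have st Z i j : vector_field V Z -> smooth_fun V (fun q => theta Z q i j).
  by move=> vZ; apply: (conn_form_smooth oV connF fsmooth).
have sn Z : vector_field V Z ->
    sp_smooth V (fun q => nabla kn kr (Z q) (omega Z q) (theta Z q) (fun y => phi (s y)) q).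
  by move=> vZ; apply: nabla_smooth => // i j; [apply: so|apply: st].
(* The local formula applies twice, because [DS T phi] is again a section. *)
have D2 Z T : vector_field V Z -> vector_field V T ->
    DS Z (DS T phi) (s p) = nabla kn kr (Z p) (omega Z p) (theta Z p)
      (fun q => nabla kn kr (T q) (omega T q) (theta T q) (fun y => phi (s y)) q) p.
  move=> vZ vT; rewrite (DS_nabla vZ (GD T vT) Vp).
  by apply: (nabla_local _ _ _ _ oV Vp (vZ.1 p Vp) (sn T vT)) => q Vq; apply: DS_nabla.
have ko Z : vector_field V Z -> skew (omega Z p).
  by move=> vZ; apply: (conn_form_skew oV connD metricD gK ginv (@metricC _ _ _ g V)).
have kt Z : vector_field V Z -> skew (theta Z p).
  by move=> vZ; apply: (conn_form_skew oV connF metricF sgK finv fC).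
rewrite /curvature (D2 X Y vX vY) (D2 Y X vY vX) (DS_nabla vB Gphi Vp).
rewrite (nabla_curvature _ _ oV vX vY Vp _ _ (fun i j => so X i j vX) (fun i j => so Y i j vY)
  (fun i j => st X i j vX) (fun i j => st Y i j vY)
  (ko X vX) (ko Y vY) (kt X vX) (kt Y vY) spsi).
have -> : curv_form gip D id u X Y p = derive_mx (X p) (omega Y) - derive_mx (Y p) (omega X)
    - omega (bracket X Y) p + (omega Y p *m omega X p - omega X p *m omega Y p).
  apply/matrixP => i j.
  rewrite (structure_equation oV connD metricD gK ginv (@metricC _ _ _ g V)
    (@metricB _ _ _ g V) vu uframe gpars _ _ vX vY Vp).
  by rewrite mx3E !derive_mxE.
have -> : curv_form fip DF sg h X Y p = derive_mx (X p) (theta Y) - derive_mx (Y p) (theta X)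
    - theta (bracket X Y) p + (theta Y p *m theta X p - theta X p *m theta Y p).
  apply/matrixP => i j.
  rewrite (structure_equation oV connF metricF sgK finv fC fB Gh fframe fpars
    _ _ vX vY Vp).
  by rewrite mx3E !derive_mxE.
by [].
Qed.

Variables (e : 'I_n -> vfield M) (f : 'I_r -> pb_total PF -> 'cV[R]_r).
Hypotheses (frame_e : orthonormal_frame g V e) (frame_f : F_frame V f).
Variable p : M.
Hypothesis Vp : V p.

Let ve i : vector_field V (e i). Proof. exact: frame_e.1. Qed.
Let Gf k : F_section V (f k). Proof. exact: frame_f.1. Qed.

Let a := \matrix_(i, l) ip gip id (e i) (u l) p.
Let b := \matrix_(k, l) ip fip sg (f k) (h l) p.
(** [E i] and [Fv k] are the vectors [e i] and [f k] at [p] as Clifford elements, in the coordinates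
    of the frames carried by [s p], through which the fiber is identified with the spinor space. *)
Let E := change_frame (@clgen R n) a.
Let Fv := change_frame (@clgen R r) b.

Let T i j k l := ip gip id (curvature D (e i) (e j) (e k)) (e l) p.
Let Th i j k l := ip fip sg (curvature DF (e i) (e j) (f k)) (f l) p.

Let a_orth : a *m a^T = 1%:M.
Proof.
apply: (frame_orth gpars ve Vp) => i j.
by have [_ ee _] := frame_e.2 p Vp; apply: ee.
Qed.

Let b_orth : b *m b^T = 1%:M.
Proof.
apply: (frame_orth fpars Gf Vp) => i j.
by apply: frame_f.2; rewrite sgK.
Qed.

Let E_family : clifford_family E.
Proof. exact: change_frame_family (@clgen_family R n) a_orth. Qed.

Let cliffE i (w : spinor R n r m) : cliff kn (s p) (e i p) w = clact kn (E i) w.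
Proof.
have <- : clvec (\col_k g p (e i p) (frm (s p) k)) = E i.
  by apply: eq_bigr => k _; rewrite !mxE.
by rewrite /cliff ls.1.
Qed.

Let kappaE k l (w : spinor R n r m) : kappa_F kr (f k (sg p)) (f l (sg p)) w = kappam kr (Fv k * Fv l) w.
Proof.
have fE k' : clvec (f k' (sg p)) = Fv k'.
  by apply: eq_bigr => j _; rewrite mxE fh.
by rewrite /kappa_F !fE.
Qed.

(** Both the curvature matrices and the Clifford generators are moved to the given frames; by
    [bivector_change_frame] the two changes compensate. *)
Let curvE i j : curvature DS (e i) (e j) phi (s p) =
  clact kn (bivector E (\matrix_(k, l) T i j k l)) (phi (s p))
  + kappam kr (bivector Fv (\matrix_(k, l) Th i j k l)) (phi (s p)).
Proof.
have vi := ve i; have vj := ve j.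
have -> : \matrix_(k, l) T i j k l = a *m curv_form gip D id u (e i) (e j) p *m a^T.
  exact: (curvature_change_frame oV connD metricD gK ginv gsmooth (@metricC _ _ _ g V)
    (@metricB _ _ _ g V) vu gpars vi vj ve Vp).
have -> : \matrix_(k, l) Th i j k l = b *m curv_form fip DF sg h (e i) (e j) p *m b^T.
  exact: (curvature_change_frame oV connF metricF sgK finv fsmooth fC fB Gh fpars
    vi vj Gf Vp).
have sk1 := curv_form_skew oV connD metricD gK ginv gsmooth (@metricC _ _ _ g V)
    (@metricB _ _ _ g V) vu vi vj Vp.
have sk2 := curv_form_skew oV connF metricF sgK finv fsmooth fC fB Gh vi vj Vp.
rewrite (bivector_change_frame (@clgen_family R n) a_orth sk1).
rewrite (bivector_change_frame (@clgen_family R r) b_orth sk2).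
exact: DS_curvature.
Qed.

Let T12 i j k l : T j i k l = - T i j k l.
Proof.
exact: (ip_curvatureC oV connD gK (@metricB _ _ _ g V) (ve i) (ve j) (ve k) (ve l) Vp).
Qed.

Let T34 i j k l : T i j l k = - T i j k l.
Proof.
exact: (curvature_skew oV connD metricD gK ginv gsmooth (@metricC _ _ _ g V)
  (@metricB _ _ _ g V) (ve i) (ve j) (ve k) (ve l) Vp).
Qed.

Let Th12 i j k l : Th j i k l = - Th i j k l.
Proof.
exact: (ip_curvatureC oV connF sgK fB (ve i) (ve j) (Gf k) (Gf l) Vp).
Qed.

Let curvature_tangent i j k : tangent p (curvature D (e i) (e j) (e k) p).
Proof.
have vD X Y : vector_field V X -> vector_field V Y -> vector_field V (D X Y).
  by move=> vX vY; apply: (conn_section connD oV vX vY).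
have vB := bracket_vector_field oV (ve i) (ve j).
have t1 := (vD _ _ (ve i) (vD _ _ (ve j) (ve k))).1 p Vp.
have t2 := (vD _ _ (ve j) (vD _ _ (ve i) (ve k))).1 p Vp.
have t3 := (vD _ _ vB (ve k)).1 p Vp.
rewrite /curvature addrC -scaleN1r; apply: (tangent_scaleD (-1) t3).
by rewrite addrC -scaleN1r; apply: (tangent_scaleD (-1) t2 t1).
Qed.

Let T_bianchi i j k l : T i j k l + T j k i l + T k i j l = 0.
Proof.
have tl := (ve l).1 p Vp.
have t1 := curvature_tangent i j k; have t2 := curvature_tangent j k i.
have t3 := curvature_tangent k i j.
have B := first_bianchi LC oV (ve i) (ve j) (ve k) Vp.
have g0 : g p 0 (e l p) = 0.
  have := ip_linear g (-1) (@tangent0 _ _ M p) (@tangent0 _ _ M p) tl.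
  by rewrite scaler0 addr0 mulN1r addNr.
move: B g0; rewrite -addrA -[X in X + _]scale1r -[X in _ + (X + _)]scale1r => <-.
rewrite (ip_linear g 1 t1 (tangent_scaleD 1 t2 t3) tl) (ip_linear g 1 t2 t3 tl).
by rewrite !mul1r addrA.
Qed.

Let TE (w : spinor R n r m) : \sum_i \sum_j clact kn (E i * E j * bivector E (\matrix_(k, l) T i j k l)) w =
  (scalar_curvature g D e p / 2)%:C%C *: w.
Proof.
have cl := @clact_linl R n r m kn.
transitivity (clact kn (\sum_i \sum_j E i * E j * bivector E (\matrix_(k, l) T i j k l)) w).
  by rewrite (act_suml0 cl); apply: eq_bigr => i _; rewrite (act_suml0 cl).
rewrite (bianchi_contraction E_family T12 T34 T_bianchi) (actZl cl) clact1 mulrC.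
by [].
Qed.

(** For [i < j] the vectors [e i], [e j] are orthogonal, so the wedge acts as the Clifford product.
    Both factors being skew in [i], [j], the sum is half the full one. *)
Let Theta_actE k l (w : spinor R n r m) : Theta_act DF kn e f k l (s p) w =
  2^-1 *: \sum_i \sum_j (Th i j k l)%:C%C *: clact kn (E i * E j) w.
Proof.
have cl := @clact_linl R n r m kn.
rewrite -(sum_lt_half (V := spinor R n r m)); first last.
- move=> i j; have [->//|ij] := eqVneq i j.
  rewrite (Th12 i j) (family_swap i j E_family) (negPf ij) mulr0 oppr0 scale0r sub0r.
  by rewrite (actNl cl) rmorphN scaleNr scalerN opprK.
- move=> i; have : Th i i k l = 0.
    by apply/eqP; rewrite -[_ == 0](mulrn_eq0 _ 2) mulr2n {1}Th12 addNr.
  by move=> ->; rewrite rmorph0 scale0r.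
apply: eq_bigr => i _; apply: eq_bigr => j ij.
rewrite /cliff_wedge (ls.1 p Vp) cliffE cliffE -(clactM kn (E i) (E j)).
have [_ ee _] := frame_e.2 p Vp; rewrite ee -val_eqE /= (ltn_eqF ij) rmorph0 scale0r addr0.
by [].
Qed.

(** [TE] accounts for the part from [TM]. In the part from [F] the 1/2 of [bivector Fv], kept inside
    [H], is exactly the 1/2 of [Theta_actE]. *)
Lemma clifford_curvature :
  \sum_(i < n) \sum_(j < n)
     cliff kn (s p) (e i p) (cliff kn (s p) (e j p) (curvature DS (e i) (e j) phi (s p)))
  = (scalar_curvature g D e p / 2)%:C%C *: phi (s p)
    + \sum_(k < r) \sum_(l < r | (k < l)%N)
        Theta_act DF kn e f k l (s p) (kappa_F kr (f k (sg p)) (f l (sg p)) (phi (s p))).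
Proof.
move: curvE; set w := phi (s p) => cE.
have kl := @kappam_linl R n r m kr.
pose H i j k l := 2^-1 *: ((Th i j k l)%:C%C *: clact kn (E i * E j) (kappam kr (Fv k * Fv l) w)).
have S i j : cliff kn (s p) (e i p) (cliff kn (s p) (e j p) (curvature DS (e i) (e j) phi (s p))) =
   clact kn (E i * E j * bivector E (\matrix_(k, l) T i j k l)) w +
   \sum_(k < r) \sum_(l < r | (k < l)%N) H i j k l.
  rewrite cliffE cliffE cE -(clactM kn (E i) (E j)).
  rewrite (clactDr kn (E i * E j)) -(clactM kn (E i * E j)); congr (_ + _).
  have lin : sp_linear (clact kn (E i * E j) : spinor R n r m -> spinor R n r m).
    by move=> c x y; apply: clact_linr.
  rewrite (act_bivector kl) (sp_linearZ _ _ lin) (sp_linear_sum _ _ _ lin) scaler_sumr.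
  apply: eq_bigr => k _; rewrite (sp_linear_sum _ _ _ lin) scaler_sumr.
  apply: eq_bigr => l _; rewrite (sp_linearZ _ _ lin) /H mxE.
  by [].
transitivity (\sum_i \sum_j clact kn (E i * E j * bivector E (\matrix_(k, l) T i j k l)) w
   + \sum_i \sum_j \sum_(k < r) \sum_(l < r | (k < l)%N) H i j k l).
  rewrite -big_split; apply: eq_bigr => i _ /=; rewrite -big_split.
  by apply: eq_bigr => j _; apply: S.
rewrite TE; apply: (congr1 (+%R _)).
under eq_bigr => i _ do rewrite exchange_big /=.
rewrite exchange_big; apply: eq_bigr => k _ /=.
under eq_bigr => i _ do rewrite exchange_big /=.
rewrite exchange_big; apply: eq_bigr => l _ /=.
rewrite Theta_actE kappaE scaler_sumr; apply: eq_bigr => i _.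
by rewrite scaler_sumr.
Qed.

End Curvature.

Theorem proposition3p2 (R : realType) (n r m : nat) (hr : (2 <= r)%N)
    (M : manifold R n) (orientedM : oriented M) (g : metric M)
    (D : vfield M -> vfield M -> vfield M) (LC : levi_civita g D)
    (PF : so_bundle M r)
    (DF : vfield M -> (pb_total PF -> 'cV[R]_r) -> pb_total PF -> 'cV[R]_r)
    (metricDF : F_connection DF)
    (kn : spinor_rep R n) (kr : spinor_rep R r)
    (P : spin_structure g PF (@ker_spinr R n r))
    (K : set (clifford R n * clifford R r)) (Q : spin_structure g PF K)
    (globS : globally_defined m P Q)
    (DS : vfield M -> (pb_total Q -> spinor R n r m) -> pb_total Q -> spinor R n r m)
    (inducedDS : induced_connection D DF kn kr DS)
    (U : set M) (openU : open U)
    (e : 'I_n -> vfield M) (frame_e : orthonormal_frame g U e)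
    (f : 'I_r -> pb_total PF -> 'cV[R]_r) (frame_f : F_frame U f)
    (phi : pb_total Q -> spinor R n r m)
    (section_phi : S_section kn kr [set: M] phi) :
  forall q : pb_total Q, U (pb_proj Q q) ->
    \sum_(i < n) \sum_(j < n)
      cliff kn q (e i (pb_proj Q q)) (cliff kn q (e j (pb_proj Q q))
        (curvature DS (e i) (e j) phi q))
    = (scalar_curvature g D e (pb_proj Q q) / 2)%:C%C *: phi q
      + \sum_(k < r) \sum_(l < r | (k < l)%N)
          Theta_act DF kn e f k l q
            (kappa_F kr (f k (auxmap q)) (f l (auxmap q)) (phi q)).
Proof.
move=> q Uq.
have [V [s [[oV Vq VU sq] [ls vu lsg sm]]]] := section_through m kn kr openU Uq.
have [h [Gh hE]] := F_section_frame oV lsg.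
have S_sub W : S_section kn kr W phi.
  split=> [b x _|i j]; first exact: section_phi.1.
  by apply: smooth_fun_sub (section_phi.2 i j) => y [].
have frame_eV : orthonormal_frame g V e.
  by split=> [i|p /VU]; [apply: vector_field_sub VU (frame_e.1 i)|apply: frame_e.2].
have frame_fV : F_frame V f.
  by split=> [k|b /VU]; [apply: F_section_sub VU (frame_f.1 k)|apply: frame_f.2].
have := clifford_curvature LC metricDF inducedDS oV ls vu lsg Gh hE
  (S_sub V) (sm phi (S_sub U)) frame_eV frame_fV Vq.
by rewrite sq.
Qed.
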